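(* Let $n\ge1$ and let $V\subset\mathbb{C}^{n+1}$ be the hypersurface defined by an irreducible polynomial $p(X,Y_1,\ldots,Y_n)\in\mathbb{C}[X,Y_1,\ldots,Y_n]$ with $\frac{\partial p}{\partial Y_n}\neq0$. Then there are infinitely many $z\in\mathbb{H}_n$ such that $(z,j(z),j_2(z),\ldots,j_n(z))\in V$.
   Context: $\mathbb{H}=\{z\in\mathbb{C}:\mathrm{Im}(z)>0\}$ and $j:\mathbb{H}\to\mathbb{C}$ is the modular $j$ function (the unique holomorphic $\mathrm{SL}_2(\mathbb{Z})$-invariant function on $\mathbb{H}$ with Fourier expansion $q^{-1}+\sum_{k\ge0}a_kq^k$, $q=e^{2\pi i z}$). Define $j_1=j$, $j_{m+1}=j\circ j_m$, and $\mathbb{H}_1=\mathbb{H}$, $\mathbb{H}_{m+1}=\{z\in\mathbb{H}_m: j_m(z)\in\mathbb{H}\}$, so $\mathbb{H}_m$ is the domain of definition of $j_m$. *)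

(* Defs.v *)
From HB Require Import structures.
From mathcomp Require Import all_boot all_order all_algebra.
From mathcomp Require Import all_classical all_reals all_analysis.
From mathcomp Require Import complex.
From mathcomp Require Import -(notations) mpoly.

Set Implicit Arguments.
Unset Strict Implicit.
Unset Printing Implicit Defensive.

Import Order.TTheory GRing.Theory Num.Theory.
Import numFieldNormedType.Exports.

Local Open Scope classical_set_scope.
Local Open Scope ring_scope.
Local Open Scope complex_scope.

(* The notations of multinomials clash with those of mathcomp-analysis and are
   not imported: [mpoly n K] is {mpoly K[n]}, [meval v p] is p.@[v] and
   [mderiv i p] is p^`M(i). *)

Definition upper_half_plane (R : realType) : set R[i] :=
  [set z | 0 < complex.Im z].

Definition cexp (R : realType) (w : R[i]) : R[i] :=
  (expR (complex.Re w))%:C * (cos (complex.Im w) +i* sin (complex.Im w)).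

Definition nome (R : realType) (z : R[i]) : R[i] :=
  cexp (2 * pi%:C * 'i * z).

(* [R[i]^o] is [R[i]] as a normed space over itself, so that [derivable]
   means complex differentiable. *)
Definition holomorphic_on (R : realType) (D : set R[i]) (f : R[i] -> R[i]) :=
  forall z, D z -> derivable (f : R[i]^o -> R[i]^o) z 1.

Definition SL2Z_invariant (R : realType) (f : R[i] -> R[i]) :=
  forall (a b c d : int), a * d - b * c = 1 ->
  forall z, upper_half_plane z ->
    f ((a%:~R * z + b%:~R) / (c%:~R * z + d%:~R)) = f z.

(* [f] is the modular j function. The values of [f] outside the upper half
   plane are unconstrained junk. The constant coefficient 744 is the classical
   normalization (j(i) = 1728, j(exp(2 pi i / 3)) = 0): the other conditions
   determine [f] on the upper half plane only up to an additive constant. *)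
Definition is_modular_j (R : realType) (f : R[i] -> R[i]) :=
  [/\ holomorphic_on (@upper_half_plane R) f,
      SL2Z_invariant f
    & exists a : nat -> R[i], a 0%N = 744 /\
        forall z, upper_half_plane z ->
          (fun N => (nome z)^-1 + \sum_(0 <= k < N) a k * nome z ^+ k : R[i]^o)
            @ \oo --> (f z : R[i]^o)].

(* j_m is [iter m j], so j_0 is the identity. Accordingly the recursion for
   H_m is started at H_0 = C, which gives H_1 = H, the domain of j_1 = j. *)
Fixpoint iter_dom (R : realType) (j : R[i] -> R[i]) (m : nat) : set R[i] :=
  if m is k.+1 then
    [set z | iter_dom j k z /\ upper_half_plane (iter k j z)]
  else setT.

(* The point (z, j(z), j_2(z), ..., j_n(z)) of C^(n+1). *)
Definition iter_point (R : realType) (j : R[i] -> R[i]) (n : nat) (z : R[i]) :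
  'I_n.+1 -> R[i] := fun k => iter k j z.
Arguments iter_point {R} j n z k.

Definition irreducible_mpoly (K : fieldType) (n : nat) (p : mpoly n K) :=
  [/\ p != 0, p \isn't a GRing.unit
    & forall q r : mpoly n K,
        p = q * r -> q \is a GRing.unit \/ r \is a GRing.unit].

Definition zero_locus (K : fieldType) (n : nat) (p : mpoly n K) :
  set ('I_n -> K) := [set v | meval v p = 0].

(* Main.v *)
(* Induction on [n], for any polynomial [p] that involves [Y_n]. For
   all but finitely many real [r], the polynomial [p(r, Y_1, ..., Y_n)] involves
   [Y_n], hence vanishes at (w, j w, ..., j_(n-1) w) for some [w], and [w = j z0]
   because [j] is surjective. So [G r z := p(r, j z, ..., j_n z)] vanishes at
   [z0].
   - If [G r] is not identically zero near [z0], choose [g_m] in SL_2(Z) with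
     [g_m z] converging to [r] locally uniformly. By Hurwitz's theorem
     [z |-> G (g_m z) z] has a zero [z_m] near [z0] for large [m]; as
     [j (g_m z_m) = j z_m], the points [g_m z_m] are solutions, and their
     imaginary parts tend to 0.
   - If [G r] vanishes identically near some [z0(r)] for all those [r], then, as
     the reals are uncountable, one Gaussian rational [z] satisfies [G r z = 0]
     for infinitely many [r], hence for all [r], and the whole orbit of [z]
     consists of solutions.
   The complex analysis needed (maximum modulus, isolated zeros, Hurwitz) is
   proved without integration, for functions having Taylor expansions of all
   orders at every point; [j] is one, by its q-expansion. *)
Require Import Defs.
From mathcomp Require Import all_boot all_order all_algebra.
From mathcomp Require Import all_classical all_reals all_analysis.
From mathcomp Require Import complex.
From mathcomp Require Import -(notations) mpoly.
From mathcomp Require Import ring lra.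

Set Implicit Arguments.
Unset Strict Implicit.
Unset Printing Implicit Defensive.

Import Order.TTheory GRing.Theory Num.Theory.
Import numFieldNormedType.Exports.
Import Normc.

Local Open Scope classical_set_scope.
Local Open Scope ring_scope.
Local Open Scope complex_scope.

Local Notation Re := (@complex.Re _).
Local Notation Im := (@complex.Im _).

(** * The modulus of a complex number *)

Section ComplexModulus.
Variable R : realType.
Implicit Types (x y z w : R[i]) (r : R).

Lemma normCE z : `|z| = (normc z)%:C.
Proof. by []. Qed.

Lemma normc_ge0 z : 0 <= normc z.
Proof. by rewrite -lecR -normCE normr_ge0. Qed.

Lemma normc_eq0 z : (normc z == 0) = (z == 0).
Proof.
by apply/eqP/eqP => [/eq0_normc//|->]; rewrite normc0.
Qed.

Lemma normc_gt0 z : (0 < normc z) = (z != 0).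
Proof. by rewrite lt_def normc_ge0 andbT normc_eq0. Qed.

Lemma normcX z n : normc (z ^+ n) = normc z ^+ n.
Proof.
elim: n => [|n IH]; first by rewrite !expr0 normc1.
by rewrite !exprS normcM IH.
Qed.

Lemma normc_real r : normc r%:C = `|r|.
Proof. by rewrite /normc /= expr0n addr0 sqrtr_sqr. Qed.

Lemma normcB x y : normc (x - y) = normc (y - x).
Proof. by rewrite -normcN opprB. Qed.

Lemma normc_sqr z : normc z ^+ 2 = Re z ^+ 2 + Im z ^+ 2.
Proof. by case: z => a b /=; rewrite sqr_sqrtr // addr_ge0 // sqr_ge0. Qed.

Lemma Re_le_normc z : `|Re z| <= normc z.
Proof.
by rewrite -ler_sqr ?nnegrE ?normc_ge0// normc_sqr real_normK ?num_real//
  lerDl sqr_ge0.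
Qed.

Lemma Im_le_normc z : `|Im z| <= normc z.
Proof.
by rewrite -ler_sqr ?nnegrE ?normc_ge0// normc_sqr real_normK ?num_real//
  lerDr sqr_ge0.
Qed.

Lemma normc_le_ReIm z : normc z <= `|Re z| + `|Im z|.
Proof.
case: z => a b; rewrite -[a +i* b]/((a +i* b)%C).
have -> : (a +i* b)%C = a%:C + 'i * b%:C by rewrite [LHS]complexE.
apply: le_trans (le_normcD _ _) _.
rewrite normcM !normc_real /= !(mul0r,mul1r,subr0,add0r,addr0).
by rewrite expr0n expr1n add0r sqrtr1 mul1r; simpc.
Qed.

Lemma cReD x y : Re (x + y) = Re x + Re y. Proof. by case: x y => [? ?] [? ?]. Qed.
Lemma cImD x y : Im (x + y) = Im x + Im y. Proof. by case: x y => [? ?] [? ?]. Qed.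
Lemma cReN x : Re (- x) = - Re x. Proof. by case: x. Qed.
Lemma cImN x : Im (- x) = - Im x. Proof. by case: x. Qed.

Lemma cReM (x y : R[i]) : Re (x * y) = Re x * Re y - Im x * Im y.
Proof. by case: x y => [? ?] [? ?]. Qed.
Lemma cImM (x y : R[i]) : Im (x * y) = Re x * Im y + Im x * Re y.
Proof. by case: x y => [? ?] [? ?]. Qed.

Lemma Re_intr (m : int) : Re (m%:~R : R[i]) = m%:~R.
Proof. by rewrite -(rmorph_int (real_complex R)). Qed.
Lemma Im_intr (m : int) : Im (m%:~R : R[i]) = 0.
Proof. by rewrite -(rmorph_int (real_complex R)). Qed.

Lemma Im_inv (z : R[i]) : Im (z^-1) = - Im z / normc z ^+ 2.
Proof. by rewrite normc_sqr; case: z => x y /=; rewrite mulNr. Qed.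

Lemma normcD_ge x y : normc x - normc y <= normc (x + y).
Proof. by have := le_normcD (x + y) (- y); rewrite addrK normcN; lra. Qed.

End ComplexModulus.

(** * Local estimates and Taylor expansions *)

Section Near0.
Variable R : realType.
Implicit Types (P Q : R[i] -> Prop).

(** The variable is the increment from the point under study. An explicit radius keeps all later
    estimates as plain real inequalities in [normc]. *)
Definition near0 P := exists2 d : R, 0 < d & forall w, normc w < d -> P w.

Lemma near0W P Q : (forall w, P w -> Q w) -> near0 P -> near0 Q.
Proof. by move=> PQ [d d0 Pd]; exists d => // w /Pd /PQ. Qed.

Lemma near0T P : (forall w, P w) -> near0 P.
Proof. by move=> PT; exists 1. Qed.

Lemma near0I P Q : near0 P -> near0 Q -> near0 (fun w => P w /\ Q w).
Proof.
move=> [d d0 Pd] [e e0 Qe]; exists (Num.min d e); first by rewrite lt_min d0.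
by move=> w; rewrite lt_min => /andP[/Pd ? /Qe].
Qed.

Lemma near0_at0 P : near0 P -> P 0.
Proof. by case=> d d0; apply; rewrite normc0. Qed.

Lemma near0_lt (e : R) : 0 < e -> near0 (fun w => normc w < e).
Proof. by exists e. Qed.

(** The bound includes [w = 0], so a positive order forces [e 0 = 0], and order 0 means boundedness
    near 0. *)
Definition bigO n (e : R[i] -> R[i]) :=
  exists K, near0 (fun w => normc (e w) <= K * normc w ^+ n).

Lemma bigO_pos n e : bigO n e ->
  exists2 K, 0 < K & near0 (fun w => normc (e w) <= K * normc w ^+ n).
Proof.
move=> [K H]; exists (`|K| + 1); first by rewrite ltr_wpDl.
apply: near0W H => w H; apply: le_trans H _.
rewrite ler_wpM2r ?exprn_ge0 ?normc_ge0//.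
by rewrite (le_trans (ler_norm _))// lerDl.
Qed.

Lemma bigO_eq n e f : (forall w, e w = f w) -> bigO n e -> bigO n f.
Proof. by move=> ef [K H]; exists K; apply: near0W H => w; rewrite ef. Qed.

Lemma bigO_near n e f : near0 (fun w => e w = f w) -> bigO n e -> bigO n f.
Proof.
by move=> ef [K H]; exists K; apply: near0W (near0I ef H) => w [->].
Qed.

Lemma bigO_cst c : bigO 0 (fun=> c).
Proof. by exists (normc c); apply: near0T => w; rewrite expr0 mulr1. Qed.

Lemma bigO_id : bigO 1 id.
Proof. by exists 1; apply: near0T => w; rewrite mul1r expr1. Qed.

Lemma bigOD n e f : bigO n e -> bigO n f -> bigO n (fun w => e w + f w).
Proof.
move=> [K He] [L Hf]; exists (K + L); apply: near0W (near0I He Hf) => w [He' Hf'].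
by rewrite mulrDl; apply: le_trans (le_normcD _ _) (lerD He' Hf').
Qed.

Lemma bigOM n m e f : bigO n e -> bigO m f -> bigO (n + m) (fun w => e w * f w).
Proof.
move=> [K He] [L Hf]; exists (K * L); apply: near0W (near0I He Hf) => w [He' Hf'].
by rewrite normcM exprD mulrACA; apply: ler_pM; rewrite ?normc_ge0.
Qed.

Lemma bigOX n e : bigO 1 e -> bigO n (fun w => e w ^+ n).
Proof.
move=> H; elim: n => [|n IH]; first exact: bigO_cst.
by apply: bigO_eq (bigOM H IH) => w; rewrite exprS.
Qed.

Lemma bigOW n m e : (m <= n)%N -> bigO n e -> bigO m e.
Proof.
move=> mn /bigO_pos[K K0 H]; exists K.
apply: near0W (near0I (near0_lt ltr01) H) => w [w1 Hw]; apply: le_trans Hw _.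
by rewrite ler_pM2l// ler_wiXn2l// ?normc_ge0// ltW.
Qed.

Lemma bigO_comp n e u : bigO n e -> bigO 1 u -> bigO n (fun w => e (u w)).
Proof.
move=> /bigO_pos[K K0 [d d0 H]] /bigO_pos[L L0 Hu]; exists (K * L ^+ n).
have d1 : 0 < d / L by rewrite divr_gt0.
apply: near0W (near0I (near0_lt d1) Hu) => w [wd Hw].
rewrite expr1 in Hw.
have uLd : normc (u w) < d.
  by apply: le_lt_trans Hw _; rewrite mulrC -ltr_pdivlMr.
apply: le_trans (H _ uLd) _; rewrite -mulrA ler_pM2l//.
by rewrite -exprMn lerXn2r// ?nnegrE ?normc_ge0// mulr_ge0 ?normc_ge0// ltW.
Qed.

Lemma bigO_horner (p : {poly R[i]}) u :
  bigO 0 u -> bigO 0 (fun w => p.[u w]).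
Proof.
move=> H; elim/poly_ind: p => [|p c IH].
  by apply: bigO_eq (bigO_cst 0) => w; rewrite horner0.
apply: bigO_eq (bigOD (bigOM IH H) (bigO_cst c)) => w.
by rewrite hornerMXaddC.
Qed.

Lemma bigO_poly (p : {poly R[i]}) : bigO 0 (fun w => p.[w]).
Proof. exact/bigO_horner/(bigOW _ bigO_id). Qed.

(** Horner induction: [P u * u - P v * v = (P u - P v) * u + P v * (u - v)], where both terms have
    order [n]. *)
Lemma bigO_hornerB n (p : {poly R[i]}) u v : bigO 0 u -> bigO 0 v ->
  bigO n (fun w => u w - v w) -> bigO n (fun w => p.[u w] - p.[v w]).
Proof.
move=> Hu Hv Huv; elim/poly_ind: p => [|p c IH].
  by exists 0; apply: near0T => w; rewrite !horner0 subr0 mul0r normc0.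
have Hp := bigO_horner p Hv.
have H2 := bigOM Hp Huv; rewrite add0n in H2.
have H1 := bigOM IH Hu; rewrite addn0 in H1.
by apply: bigO_eq (bigOD H1 H2) => w; rewrite !hornerMXaddC; ring.
Qed.

Lemma bigO_at0 n e : (0 < n)%N -> bigO n e -> e 0 = 0.
Proof.
move=> n0 [K /near0_at0]; rewrite normc0 expr0n gtn_eqF//= mulr0 => H.
by apply/eqP; rewrite -normc_eq0 eq_le H normc_ge0.
Qed.

Lemma poly_splitX n (p : {poly R[i]}) :
  exists q : {poly R[i]}, p = take_poly n p + q * 'X^n.
Proof. by exists (drop_poly n p); rewrite poly_take_drop. Qed.

End Near0.

(** * Taylor expansions to all orders and their closure properties *)

Section Taylor.
Variable R : realType.
Implicit Types (f g : R[i] -> R[i]) (z : R[i]).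

(* Taylor expansions to all orders; unlike analyticity, this is visibly stable
   under composition and inversion. *)
Definition taylor f z := forall n,
  exists p : {poly R[i]}, bigO n (fun w => f (z + w) - p.[w]).

Lemma taylor_bounded f z : taylor f z -> bigO 0 (fun w => f (z + w)).
Proof.
move=> /(_ 0%N)[p H]; apply: bigO_eq (bigOD H (bigO_poly p)) => w.
by rewrite subrK.
Qed.

Lemma taylor_near f g z :
  near0 (fun w => f (z + w) = g (z + w)) -> taylor f z -> taylor g z.
Proof.
move=> fg H n; have [p Hp] := H n; exists p; apply: bigO_near Hp.
by apply: near0W fg => w ->.
Qed.

Lemma taylor_cst c z : taylor (fun=> c) z.
Proof.
move=> n; exists c%:P; exists 0; apply: near0T => w.
by rewrite hornerC subrr normc0 mul0r.
Qed.

Lemma taylor_id z : taylor id z.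
Proof.
move=> n; exists (z%:P + 'X); exists 0; apply: near0T => w.
by rewrite !hornerE subrr normc0.
Qed.

Lemma taylorD f g z : taylor f z -> taylor g z -> taylor (fun x => f x + g x) z.
Proof.
move=> Hf Hg n; have [p Hp] := Hf n; have [q Hq] := Hg n; exists (p + q).
by apply: bigO_eq (bigOD Hp Hq) => w; rewrite hornerD; ring.
Qed.

Lemma taylorM f g z : taylor f z -> taylor g z -> taylor (fun x => f x * g x) z.
Proof.
move=> Hf Hg n; have [p Hp] := Hf n; have [q Hq] := Hg n; exists (p * q).
have H1 := bigOM (taylor_bounded Hf) Hq; rewrite add0n in H1.
have H2 := bigOM Hp (bigO_poly q); rewrite addn0 in H2.
by apply: bigO_eq (bigOD H1 H2) => w; rewrite hornerM; ring.
Qed.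

Lemma taylorX f z n : taylor f z -> taylor (fun x => f x ^+ n) z.
Proof.
move=> Hf; elim: n => [|n IH]; first exact: taylor_cst.
by apply: taylor_near (taylorM Hf IH); apply: near0T => w; rewrite exprS.
Qed.

Lemma taylor_increment f z : taylor f z -> bigO 1 (fun w => f (z + w) - f z).
Proof.
move=> /(_ 1%N)[p H]; have p0 : f z = p.[0].
  by apply/eqP; rewrite -subr_eq0; have := bigO_at0 (ltn0Sn _) H; rewrite addr0 => ->.
have H1 : bigO 1 (fun w => p.[w] - p.[0]).
  apply: bigO_hornerB; [exact: (bigOW _ (@bigO_id R))|exact: bigO_cst|].
  by apply: bigO_eq (@bigO_id R) => w; rewrite subr0.
by apply: bigO_eq (bigOD H H1) => w; rewrite p0; ring.
Qed.

Lemma taylor_continuous f z (e : R) : taylor f z -> 0 < e ->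
  near0 (fun w => normc (f (z + w) - f z) < e).
Proof.
move=> /taylor_increment /bigO_pos[K K0 H] e0.
have eK : 0 < e / K by rewrite divr_gt0.
apply: near0W (near0I (near0_lt eK) H) => w [we /le_lt_trans]; apply.
by rewrite expr1 mulrC -ltr_pdivlMr.
Qed.

(** The expansion [p] of [f] is applied to the increment of [g], which is then replaced by its own
    expansion [q - g z]; the two errors are [H1] and [H2]. *)
Lemma taylor_comp f g z : taylor g z -> taylor f (g z) ->
  taylor (fun x => f (g x)) z.
Proof.
move=> Hg Hf n; have [p Hp] := Hf n; have [q Hq] := Hg n.
exists (p \Po (q - (g z)%:P)).
have Hu := taylor_increment Hg.
have H1 := bigO_comp Hp Hu.
have H2 : bigO n (fun w => p.[g (z + w) - g z] - p.[q.[w] - g z]).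
  apply: bigO_hornerB.
  - exact: bigOW Hu.
  - by apply: bigO_eq (bigO_poly (q - (g z)%:P)) => w; rewrite !hornerE.
  - by apply: bigO_eq Hq => w; ring.
apply: bigO_eq (bigOD H1 H2) => w.
rewrite horner_comp hornerD hornerN hornerC addrA subrK.
by rewrite [g z + _]addrC subrK.
Qed.

Lemma taylor_inv z : z != 0 -> taylor (@GRing.inv R[i]) z.
Proof.
move=> z0 n; exists (\sum_(k < n) ((-1) ^+ k * z ^- k.+1) *: 'X^k).
have d0 : 0 < normc z / 2 by rewrite divr_gt0// normc_gt0.
exists (2 * normc z ^- n.+1).
have z1 : 0 < normc z by rewrite normc_gt0.
apply: near0W (near0_lt d0) => w wz.
have zw : z + w != 0.
  rewrite -normc_gt0; apply: lt_le_trans (normcD_ge _ _).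
  lra.
(* Exact remainder of the geometric series in [- w / z]. *)
have -> : (z + w)^-1 - (\sum_(k < n) ((-1) ^+ k * z ^- k.+1) *: 'X^k).[w] =
    (-1) ^+ n * w ^+ n * z ^- n * (z + w)^-1.
  apply: (mulIf zw); rewrite mulrBl mulVf// -!mulrA mulVf// mulr1.
  rewrite horner_sum.
  under eq_bigr do rewrite !hornerE.
  elim: n {d0 wz} => [|n IH].
    by rewrite big_ord0 mul0r subr0 !expr0 invr1 !mulr1.
  rewrite big_ord_recr/= mulrDl opprD addrA IH !exprS !invfM.
  by field; rewrite z0 expf_neq0.
rewrite !normcM !normcX normcN normc1 expr1n mul1r !normcV normcX.
have H : (normc (z + w))^-1 <= 2 * (normc z)^-1.
  rewrite -[2]invrK -invfM lef_pV2 ?posrE ?normc_gt0//; last first.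
    by rewrite mulr_gt0// invr_gt0.
  by apply: le_trans (normcD_ge _ _); lra.
rewrite exprS invfM.
have -> : 2 * ((normc z)^-1 * (normc z ^+ n)^-1) * normc w ^+ n =
  normc w ^+ n * (normc z ^+ n)^-1 * (2 * (normc z)^-1) by ring.
apply: ler_wpM2l => //.
by rewrite mulr_ge0 ?invr_ge0 ?exprn_ge0 ?normc_ge0.
Qed.

Lemma taylorV f z : taylor f z -> f z != 0 -> taylor (fun x => (f x)^-1) z.
Proof. by move=> Hf fz; apply: taylor_comp Hf (taylor_inv fz). Qed.

Lemma taylor_translate f z c : taylor f (z + c) -> taylor (fun x => f (x + c)) z.
Proof.
by move=> H; apply: (@taylor_comp f (fun x => x + c)) H; apply: taylorD;
  [exact: taylor_id|exact: taylor_cst].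
Qed.

Lemma taylor2 f z : taylor f z -> exists b c, exists2 K, 0 < K &
  near0 (fun w => normc (f (z + w) - (f z + b * w + c * w ^+ 2))
                    <= K * normc w ^+ 3).
Proof.
move=> /(_ 3)[p H]; exists p`_1, p`_2; apply: bigO_pos.
have p0 : f z = p`_0.
  apply/eqP; rewrite -horner_coef0 -subr_eq0.
  by have := bigO_at0 (ltn0Sn _) H; rewrite addr0 => ->.
have [q pq] := poly_splitX 3 p.
have Hq : bigO 3 (fun w => q.[w] * w ^+ 3).
  exact: (bigOM (bigO_poly q) (bigOX 3 (@bigO_id R))).
apply: bigO_eq (bigOD H Hq) => w; rewrite {1}pq hornerD hornerM hornerXn p0.
rewrite /take_poly horner_poly !big_ord_recl big_ord0 /= /bump /= expr0 !expr1.
by ring.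
Qed.

End Taylor.

(** * Maximum modulus and Hurwitz *)

Section ExtremeValue.
Variable R : realType.

Definition continuous_near (F : R[i] -> R) z :=
  forall e, 0 < e -> near0 (fun w => `|F (z + w) - F z| < e).

Lemma continuous_nearP (F : R[i] -> R) (p : R * R) :
  continuous_near F (p.1 +i* p.2) ->
  {for p, continuous (fun q : R * R => F (q.1 +i* q.2))}.
Proof.
move=> H; apply/cvgrPdist_lt => e /H[d d0 Hd].
have d2 : 0 < d / 2 by rewrite divr_gt0.
exists (ball p.1 (d / 2), ball p.2 (d / 2)).
  by split; apply: nbhsx_ballx.
move=> q [/= B1 B2]; rewrite distrC.
have -> : (q.1 +i* q.2) = (p.1 +i* p.2) + ((q.1 - p.1) +i* (q.2 - p.2)).
  by simpc; congr (_ +i* _); ring.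
apply: Hd; apply: le_lt_trans (normc_le_ReIm _) _ => /=.
move: B1 B2; rewrite -!ball_normE /ball_ /= => B1 B2.
by rewrite (splitr d) ltrD// distrC.
Qed.

(** The disc is transported to [R * R], where it is a closed subset of a compact box, so that the
    extreme value theorem applies. *)
Lemma disc_max (F : R[i] -> R) c r : 0 <= r ->
  (forall z, normc (z - c) <= r -> continuous_near F z) ->
  exists2 z0, normc (z0 - c) <= r & forall z, normc (z - c) <= r -> F z <= F z0.
Proof.
move=> r0 cF; pose A := [set p : R * R | normc ((p.1 +i* p.2) - c) <= r].
have cA : compact A.
  apply: (@subclosed_compact _ A
    (`[Re c - r, Re c + r]%classic `*` `[Im c - r, Im c + r]%classic)).
  - apply: (@preimage_closed _ _ (fun p : R * R => normc ((p.1 +i* p.2) - c))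
      [set x : R | x <= r]); last exact: closed_le.
    move=> p _.
    apply: (@continuous_nearP (fun z => normc (z - c))) => e e0.
    exists e => // w we; apply: le_lt_trans we.
    rewrite ler_norml; have := normcD_ge (p.1 +i* p.2 + w - c) (- w).
    have := normcD_ge (p.1 +i* p.2 - c) w.
    have -> : p.1 +i* p.2 + w - c - w = p.1 +i* p.2 - c by ring.
    have -> : p.1 +i* p.2 - c + w = p.1 +i* p.2 + w - c by ring.
    by rewrite normcN; lra.
  - by apply: compact_setX; exact: segment_compact.
  - move=> p /= pA.
    have := le_trans (Re_le_normc _) pA; have := le_trans (Im_le_normc _) pA.
    rewrite !(cReD, cImD, cReN, cImN) /= !ler_norml !in_itv /= => ? ?.
    by split; lra.
have A0 : A !=set0.
  exists (Re c, Im c); rewrite /A /=.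
  have -> : Re c +i* Im c = c by case: (c).
  by rewrite subrr normc0.
have [|p pA pmax] := @compact_EVT_max _ R (fun q : R * R => F (q.1 +i* q.2)) A A0 cA.
  apply: continuous_in_subspaceT => p; rewrite inE => pA.
  by apply: continuous_nearP; exact: cF.
rewrite inE in pA.
exists (p.1 +i* p.2) => // z zr.
have := pmax (Re z, Im z); rewrite inE /A /=.
by case: z zr => a b zr; apply.
Qed.

Lemma continuous_near_normc (f : R[i] -> R[i]) z :
  taylor f z -> continuous_near (fun x => normc (f x)) z.
Proof.
move=> tf e e0; apply: near0W (taylor_continuous tf e0) => w; apply: le_lt_trans.
rewrite ler_norml.
have := normcD_ge (f z) (f (z + w) - f z).
have := normcD_ge (f (z + w)) (f z - f (z + w)).
rewrite [in normc (f z - _)]normcB ![_ + (_ - _)]addrC !subrK; lra.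
Qed.

Lemma disc_normc_max (f : R[i] -> R[i]) c r : 0 <= r ->
  (forall z, normc (z - c) <= r -> taylor f z) ->
  exists2 z0, normc (z0 - c) <= r &
    forall z, normc (z - c) <= r -> normc (f z) <= normc (f z0).
Proof.
move=> r0 tf; apply: disc_max => // z zr.
exact/continuous_near_normc/tf.
Qed.

End ExtremeValue.

(** * The maximum modulus principle, by a strictly subharmonic perturbation *)

Section MaximumModulus.
Variable R : realType.
Implicit Types (f g : R[i] -> R[i]) (z c : R[i]) (r e M : R).

(* Adding [e |z - c|^2] to the harmonic function [Re (a f)] makes its average
   over [z0 + h], [z0 - h], [z0 + ih], [z0 - ih] exceed its value at [z0] by
   [e h^2 + O(h^3)]. *)
Lemma no_interior_max f a c e z0 : taylor f z0 -> 0 < e ->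
  ~ near0 (fun w => Re (a * f (z0 + w)) + e * normc (z0 + w - c) ^+ 2
     <= Re (a * f z0) + e * normc (z0 - c) ^+ 2).
Proof.
move=> /taylor2[b1 [b2 [K K0 [d d0 Hd]]]] e0 [d' d'0 Hd'].
pose L := normc a * K.
have L0 : 0 <= L by rewrite mulr_ge0 ?normc_ge0// ltW.
(* Small enough for the four test points to lie within both radii and for [h * L < e], which
   contradicts the sum of the four inequalities [key]. *)
pose h := Num.min (Num.min d d' / 2) (e / (2 * (L + 1))).
have m0 : 0 < Num.min d d' by rewrite lt_min d0.
have h0 : 0 < h by rewrite lt_min !divr_gt0 ?mulr_gt0//; lra.
have hm : h < Num.min d d'.
  apply: (@le_lt_trans _ _ (Num.min d d' / 2)); first by rewrite ge_min lexx.
  by rewrite ltr_pdivrMr// ltr_pMr// ltr1n.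
have [hd hd'] : h < d /\ h < d' by apply/andP; rewrite -lt_min.
have hL : h * (2 * (L + 1)) <= e.
  rewrite -ler_pdivlMr; last by lra.
  by rewrite /h ge_min lexx orbT.
have key (u : R[i]) : normc u = h ->
    Re (a * (b1 * u + b2 * u ^+ 2)) + e * (2 * Re (u * (z0 - c)^*) + h ^+ 2)
      <= L * h ^+ 3.
  move=> uh; have H1 := Hd u; rewrite uh in H1; have {}H1 := H1 hd.
  have H2 := Hd' u; rewrite uh in H2; have {}H2 := H2 hd'.
  set E := _ - _ in H1.
  have fE : f (z0 + u) = f z0 + b1 * u + b2 * u ^+ 2 + E by rewrite /E; ring.
  have aE : - Re (a * E) <= L * h ^+ 3.
    apply: le_trans (ler_norm _) _; rewrite normrN.
    apply: le_trans (Re_le_normc _) _.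
    by rewrite normcM /L -mulrA ler_wpM2l// normc_ge0.
  move: H2; rewrite fE !normc_sqr.
  have -> : z0 + u - c = z0 - c + u by ring.
  have := normc_sqr u; rewrite uh => ->.
  move: aE {fE H1}; clearbody E.
  case: (z0 - c) => x y; case: (u) => s t.
  rewrite !mulrDr !cReD !cImD /=.
  set A1 := Re (a * E); set A2 := Re (a * f z0).
  set A3 := Re (a * (b1 * _)); set A4 := Re (a * (b2 * _)).
  by move=> ? ?; lra.
have k1 := key h%:C; have k2 := key (- h%:C).
have k3 := key ('i * h%:C); have k4 := key (- ('i * h%:C)).
have ni : normc ('i : R[i]) = 1 by rewrite /normc /= expr0n expr1n add0r sqrtr1.
have nh : normc h%:C = h by rewrite normc_real ger0_norm// ltW.
have {}k1 := k1 nh.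
have {}k2 : _ := k2 (etrans (normcN _) nh).
have ih : normc ('i * h%:C) = h by rewrite normcM ni nh mul1r.
have {}k3 : _ := k3 ih.
have {}k4 : _ := k4 (etrans (normcN _) ih).
(* In the sum over [h], [- h], [ih], [- ih] the terms linear in [u] cancel in pairs, and those in
   [u ^+ 2] cancel because ['i ^+ 2 = - 1]. *)
have : 4 * (e * h ^+ 2) <= 4 * (L * h ^+ 3).
  rewrite [leLHS](_ : _ =
   (Re (a * (b1 * h%:C + b2 * h%:C ^+ 2)) + e * (2 * Re (h%:C * (z0 - c)^*) + h ^+ 2))
   + (Re (a * (b1 * - h%:C + b2 * (- h%:C) ^+ 2)) + e * (2 * Re (- h%:C * (z0 - c)^*) + h ^+ 2))
   + (Re (a * (b1 * ('i * h%:C) + b2 * ('i * h%:C) ^+ 2)) + e * (2 * Re ('i * h%:C * (z0 - c)^*) + h ^+ 2))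
   + (Re (a * (b1 * - ('i * h%:C) + b2 * (- ('i * h%:C)) ^+ 2)) + e * (2 * Re (- ('i * h%:C) * (z0 - c)^*) + h ^+ 2))); first by lra.
  rewrite !sqrrN exprMn sqr_i.
  case: (a) (b1) (b2) (z0 - c) => [a1 a2] [p1 p2] [q1 q2] [x y].
  by simpc => /=; ring.
have -> : L * h ^+ 3 = h * L * h ^+ 2 by ring.
have h20 : 0 < h ^+ 2 by rewrite exprn_gt0.
rewrite ler_pM2l// ler_pM2r//; nra.
Qed.

(** If [normc (f p)] exceeded [M], a rotation by a unimodular [a] would turn it into [Re (a * f p)].
    Adding a small multiple of [normc (z - c) ^+ 2] keeps the values on the circle below the value
    at [p], so the maximum over the disc is interior, against [no_interior_max]. *)
Lemma maximum_modulus f c r M p : 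
  (forall z, normc (z - c) <= r -> taylor f z) ->
  (forall z, normc (z - c) = r -> normc (f z) <= M) ->
  normc (p - c) <= r -> normc (f p) <= M.
Proof.
move=> tf Mf pr; rewrite leNgt; apply/negP => fpM.
have r0 : 0 <= r := le_trans (normc_ge0 _) pr.
(* The rotation needs [f p != 0]; otherwise [M] would be negative, which any point of the circle
   refutes. *)
have [fp0|fp0] := eqVneq (f p) 0.
  have rc : normc (c + r%:C - c) = r.
    by rewrite addrC addKr normc_real ger0_norm.
  have := Mf _ rc; move: fpM; rewrite fp0 normc0.
  by have := normc_ge0 (f (c + r%:C)); lra.
have nf : 0 < normc (f p) by rewrite normc_gt0.
pose a := (f p)^* * ((normc (f p))^-1)%:C.
have na : normc a = 1.
  rewrite normcM normc_real ger0_norm ?invr_ge0 ?normc_ge0//.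
  have -> : normc (f p)^* = normc (f p).
    by apply/complexI; rewrite -!normCE normcJ.
  by rewrite divff// gt_eqF.
have Ra : Re (a * f p) = normc (f p).
  rewrite /a mulrAC.
  have -> : (f p)^* * f p = (normc (f p) ^+ 2)%:C.
    by rewrite mulrC -sqr_normc normCE -rmorphXn.
  by rewrite -rmorphM /= expr2 mulfK ?gt_eqF.
have Rle z : Re (a * f z) <= normc (f z).
  apply: le_trans (ler_norm _) _; apply: le_trans (Re_le_normc _) _.
  by rewrite normcM na mul1r.
(* Chosen so that [M + e * r ^+ 2 < normc (f p)]. *)
pose e := (normc (f p) - M) / (2 * (r ^+ 2 + 1)).
have r20 : 0 <= r ^+ 2 by rewrite sqr_ge0.
have e0 : 0 < e by rewrite divr_gt0 ?subr_gt0//; lra.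
have er : M + e * r ^+ 2 < normc (f p).
  suff : e * (r ^+ 2 + 1) < normc (f p) - M by nra.
  rewrite /e; rewrite invfM mulrA mulfVK; last by rewrite gt_eqF//; lra.
  by lra.
pose v z := Re (a * f z) + e * normc (z - c) ^+ 2.
have cv z : normc (z - c) <= r -> continuous_near v z.
  move=> zr d d0.
  have t1 := taylorM (taylor_cst a z) (tf _ zr).
  have t2 := taylorD (taylor_id z) (taylor_cst (- c) z).
  pose B := e * (2 * r + 1) + 1.
  have B0 : 0 < B by rewrite /B; nra.
  have d1 : 0 < d / 2 by lra.
  have d2 : 0 < d / 2 / B by rewrite divr_gt0.
  apply: near0W (near0I (near0_lt ltr01) (near0I (near0_lt d2)
    (taylor_continuous t1 d1))) => w [w1 [w2 /= w3]].
  have H1 := le_lt_trans (Re_le_normc _) w3; rewrite cReD cReN in H1.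
  have H2 : `|normc (z + w - c) - normc (z - c)| <= normc w.
    rewrite ler_norml; have := normcD_ge (z + w - c) (- w).
    have := normcD_ge (z - c) w.
    have -> : z + w - c - w = z - c by ring.
    have -> : z - c + w = z + w - c by ring.
    by rewrite normcN; lra.
  have H3 : `|e * normc (z + w - c) ^+ 2 - e * normc (z - c) ^+ 2| <= d / 2.
    rewrite -mulrBr subr_sqr normrM gtr0_norm// normrM.
    have H4 : `|normc (z + w - c) + normc (z - c)| <= 2 * r + 1.
      rewrite ger0_norm ?addr_ge0 ?normc_ge0//.
      by move: H2; rewrite ler_norml; lra.
    have H5 : `|normc (z + w - c) - normc (z - c)| <= d / 2 / B by lra.
    apply: le_trans (_ : e * (d / 2 / B * (2 * r + 1)) <= _).
      by rewrite ler_pM2l// ler_pM.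
    have DB : d / 2 / B * B = d / 2 by rewrite divfK// gt_eqF.
    by move: d2 DB; move: (d / 2 / B) => D; rewrite /B => ? ?; lra.
  rewrite /v.
  have -> : Re (a * f (z + w)) + e * normc (z + w - c) ^+ 2 -
     (Re (a * f z) + e * normc (z - c) ^+ 2) = (Re (a * f (z + w)) - Re (a * f z))
    + (e * normc (z + w - c) ^+ 2 - e * normc (z - c) ^+ 2) by ring.
  by apply: le_lt_trans (ler_normD _ _) _; lra.
have [z0 z0r z0max] := disc_max r0 cv.
have z0lt : normc (z0 - c) < r.
  rewrite lt_neqAle z0r andbT; apply/eqP => z0eq.
  have := z0max _ pr; rewrite /v z0eq Ra.
  have := Rle z0; have := Mf _ z0eq.
  have : 0 <= e * normc (p - c) ^+ 2 by rewrite mulr_ge0 ?sqr_ge0 ?ltW.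
  by lra.
apply: (no_interior_max (tf _ z0r) e0 (a := a) (c := c)).
exists (r - normc (z0 - c)); first by lra.
move=> w wr; apply: z0max.
have -> : z0 + w - c = z0 - c + w by ring.
by apply: le_trans (le_normcD _ _) _; lra.
Qed.

End MaximumModulus.

(** * Isolated zeros and Hurwitz's theorem *)

Section Zeros.
Variable R : realType.
Implicit Types (f g : R[i] -> R[i]) (z : R[i]) (r d e M : R).

Lemma expr_small (q M e : R) : 0 <= q < 1 -> 0 < e ->
  exists n0, forall n, (n0 <= n)%N -> M * q ^+ n < e.
Proof.
move=> /andP[q0 q1] e0.
have /cvgrPdist_lt /(_ _ e0)[n0 _ H] : geometric M q @ \oo --> (0 : R).
  by apply: cvg_geometric; rewrite ger0_norm.
exists n0 => n /H /=; rewrite sub0r normrN; apply: le_lt_trans.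
exact: ler_norm.
Qed.

(** The quotient [f (z0 + w) / w ^+ n] still has Taylor expansions, so the maximum modulus principle
    on the disc of radius [s] gives [normc (f (z0 + w)) <= M * (normc w / s) ^+ n] for every [n].
    For [normc w < s / 2] the right side tends to 0. *)
Lemma flat_zero f z0 r : 0 < r ->
  (forall z, normc (z - z0) <= r -> taylor f z) ->
  (forall n, bigO n (fun w => f (z0 + w))) -> near0 (fun w => f (z0 + w) = 0).
Proof.
move=> r0 tf flat.
have [M M0 [d d0 fM]] := bigO_pos (flat 0%N).
pose s := Num.min r (d / 2).
have s0 : 0 < s by rewrite lt_min r0 divr_gt0.
have sr : s <= r by rewrite ge_min lexx.
have sd : s < d.
  by apply: (@le_lt_trans _ _ (d / 2)); [rewrite ge_min lexx orbT|lra].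
pose F n w := f (z0 + w) * w ^- n.
have tF n w : normc (w - 0) <= s -> taylor (F n) w.
  rewrite subr0 => ws; have [->|w0] := eqVneq w 0.
    (* At 0 the zero polynomial is an expansion of every order [m]: flatness at order [m + n + 1]
       pays for the division by [w ^+ n]. *)
    move=> m; exists 0; have [K K0 H] := bigO_pos (flat (m + n).+1).
    exists K; apply: near0W (near0I (near0_lt ltr01) H) => u [u1 Hu].
    rewrite add0r horner0 subr0 /F normcM normcV normcX.
    have [->|u0] := eqVneq u 0.
      have -> : f (z0 + 0) = 0 by apply: bigO_at0 (flat 1%N).
      by rewrite normc0 mul0r mulr_ge0 ?exprn_ge0 ?(ltW K0).
    have un : 0 < normc u by rewrite normc_gt0.
    rewrite ler_pdivrMr ?exprn_gt0// -mulrA -exprD.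
    apply: le_trans Hu _; rewrite ler_pM2l// ler_wiXn2l ?normc_ge0//; exact: ltW.
  apply: taylorM.
    have := @taylor_translate _ f w z0; rewrite addrC => H.
    have {}H := H (tf (z0 + w) _).
    apply: taylor_near (H _); first by apply: near0T => u; rewrite addrC.
    by rewrite addrC addKr (le_trans ws).
  by apply: taylorV; [exact/taylorX/taylor_id|rewrite expf_neq0].
have Fle n w : normc w <= s -> normc (F n w) <= M / s ^+ n.
  move=> ws; apply: (maximum_modulus (tF n)) => [u|]; rewrite subr0// => us.
  rewrite /F normcM normcV normcX us ler_wpM2r ?invr_ge0 ?exprn_ge0 ?(ltW s0)//.
  by have := fM u; rewrite us expr0 mulr1; apply.
exists (s / 2); first by rewrite divr_gt0.
move=> w ws; have [w0|w0] := eqVneq w 0.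
  by rewrite w0; apply: bigO_at0 (flat 1%N).
have wn : 0 < normc w by rewrite normc_gt0.
apply/eqP/negPn; rewrite -normc_gt0; apply/negP => fw.
have half : (0 <= (2^-1 : R) < 1) by lra.
have [n /(_ n (leqnn n))] := expr_small M half fw.
apply/negP; rewrite -leNgt.
have := Fle n w; rewrite /F normcM normcV normcX ler_pdivrMr ?exprn_gt0//.
move=> H; apply: le_trans (H _) _; first by lra.
rewrite -mulrA ler_pM2l// -exprVn -exprMn lerXn2r ?nnegrE//; try by lra.
  by rewrite mulr_ge0 ?invr_ge0// ltW.
by rewrite mulrC ler_pdivrMr//; lra.
Qed.

(** Since [f] is not flat at [z0], some Taylor polynomial has a first nonzero coefficient, at index
    [k]; near [z0] this term dominates the rest, and half of its modulus is a lower bound. *)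
Lemma zero_order f z0 r : 0 < r ->
  (forall z, normc (z - z0) <= r -> taylor f z) ->
  ~ near0 (fun w => f (z0 + w) = 0) ->
  exists k, exists2 c, 0 < c & near0 (fun w => c * normc w ^+ k <= normc (f (z0 + w))).
Proof.
move=> r0 tf nz; have [flat|] := pselect (forall n, bigO n (fun w => f (z0 + w))).
  by case: nz; exact: flat_zero r0 tf flat.
move=> /existsNP[n nO]; have tz : taylor f z0 by apply: tf; rewrite subrr normc0 ltW.
have [p Hp] := tz n.
have [ex|] := pselect (exists i, (i < n)%N && (p`_i != 0)); last first.
  move=> nex; case: nO; have [q pq] := poly_splitX n p.
  have p0 : take_poly n p = 0.
    apply/polyP => i; rewrite coef_take_poly coef0; case: ifP => // ilt.
    by apply/eqP/negPn/negP => pi; apply: nex; exists i; rewrite ilt.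
  have Hq := bigOM (bigO_poly q) (bigOX n (@bigO_id R)).
  apply: bigO_eq (bigOD Hp Hq) => w.
  by rewrite pq p0 add0r hornerM hornerXn subrK.
have [k /andP[kn pk] kmin] := ex_minnP ex.
have [q pq] := poly_splitX k p.
have p0 : take_poly k p = 0.
  apply/polyP => i; rewrite coef_take_poly coef0; case: ifP => // ilt.
  apply/eqP/negPn/negP => pi; have := kmin i.
  by rewrite (ltn_trans ilt kn) pi leqNgt ilt => /(_ isT).
rewrite p0 add0r in pq.
have q0 : p`_k = q.[0] by rewrite pq coefMXn ltnn subnn horner_coef0.
have Hq1 : bigO 1 (fun w => q.[w] - q.[0]).
  apply: bigO_hornerB; [exact: (bigOW _ (@bigO_id R))|exact: bigO_cst|].
  by apply: bigO_eq (@bigO_id R) => w; rewrite subr0.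
have Hq : bigO k.+1 (fun w => (q.[w] - q.[0]) * w ^+ k).
  by have := bigOM Hq1 (bigOX k (@bigO_id R)); rewrite add1n.
have /bigO_pos[K K0 H] : bigO k.+1 (fun w => f (z0 + w) - p`_k * w ^+ k).
  apply: bigO_eq (bigOD (bigOW kn Hp) Hq) => w.
  by rewrite q0 pq hornerM hornerXn; ring.
have pk0 : 0 < normc p`_k by rewrite normc_gt0.
exists k, (normc p`_k / 2); first by rewrite divr_gt0.
have d0 : 0 < normc p`_k / 2 / K by rewrite !divr_gt0.
apply: near0W (near0I (near0_lt d0) H) => w [wd].
have := normcD_ge (p`_k * w ^+ k) (f (z0 + w) - p`_k * w ^+ k).
rewrite [_ + (_ - _)]addrC subrK normcM normcX exprSr => H1 H2.
have H3 : normc w * K <= normc p`_k / 2 by rewrite -ler_pdivlMr// ltW.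
have H4 : 0 <= normc w ^+ k by rewrite exprn_ge0 ?normc_ge0.
by nra.
Qed.

(** On the circle of radius [s], [normc (f z)] is at least [2 * e], hence [normc (g z)] is at least
    [e]. Were [g] without zeros in the disc, the maximum modulus principle for [1 / g] would give
    [normc (g z0) >= e], whereas [f z0 = 0] gives [normc (g z0) < e]. The tolerance [e] does not
    depend on [g]. *)
Lemma hurwitz f z0 r d : 0 < r -> 0 < d ->
  (forall z, normc (z - z0) <= r -> taylor f z) -> f z0 = 0 ->
  ~ near0 (fun w => f (z0 + w) = 0) ->
  exists s e, [/\ 0 < s, s <= r, s <= d, 0 < e & forall g,
    (forall z, normc (z - z0) <= s -> taylor g z) ->
    (forall z, normc (z - z0) <= s -> normc (g z - f z) < e) ->
    exists2 z, normc (z - z0) <= s & g z = 0].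
Proof.
move=> r0 d0 tf fz0 nz; have [k [c c0 [d1 d10 H]]] := zero_order r0 tf nz.
pose s := Num.min (Num.min r d) (d1 / 2).
have s0 : 0 < s by rewrite !lt_min r0 d0 divr_gt0.
have sd1 : s < d1.
  by apply: (@le_lt_trans _ _ (d1 / 2)); [rewrite ge_min lexx orbT|lra].
pose e := c * s ^+ k / 2.
have e0 : 0 < e by rewrite divr_gt0// mulr_gt0// exprn_gt0.
exists s, e; split=> //; try by rewrite /s !ge_min lexx ?orbT.
move=> g tg gf.
have [[z zs gz]|ng] := pselect (exists2 z, normc (z - z0) <= s & g z = 0).
  by exists z.
have g0 z : normc (z - z0) <= s -> g z != 0.
  by move=> zs; apply/eqP => gz; apply: ng; exists z.
have zz : normc (z0 - z0) <= s by rewrite subrr normc0 ltW.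
have : normc (g z0)^-1 <= e^-1.
  apply: (@maximum_modulus _ (fun z => (g z)^-1) z0 s _ _ _ _ zz) => z zs.
    by apply: taylorV; [exact: tg|exact: g0].
  rewrite normcV lef_pV2 ?posrE ?normc_gt0 ?g0 ?zs//.
  have := H (z - z0); rewrite zs addrC subrK => /(_ sd1).
  have := gf z; rewrite zs lexx => /(_ isT).
  have := normcD_ge (f z) (g z - f z); rewrite [f z + _]addrC subrK /e; lra.
have := gf _ zz; rewrite fz0 subr0 normcV => H1.
rewrite lef_pV2 ?posrE ?normc_gt0 ?g0//; lra.
Qed.

End Zeros.

(** * Power series *)

Section Limits.
Variable R : realType.
Implicit Types (u v : nat -> R[i]) (l m : R[i]).

Definition tends u l := forall e : R, 0 < e ->
  exists n0, forall n, (n0 <= n)%N -> normc (u n - l) < e.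

Lemma cvg_tends u l : (u : nat -> R[i]^o) @ \oo --> (l : R[i]^o) -> tends u l.
Proof.
move=> /cvgrPdist_lt H e e0; have e1 : (0 : R[i]) < e%:C by rewrite ltcR.
have [n0 _ Hn] := H _ e1; exists n0 => n /Hn /=.
by rewrite distrC normCE ltcR.
Qed.

Lemma tends_unique u l m : tends u l -> tends u m -> l = m.
Proof.
move=> ul um; apply/eqP; rewrite -subr_eq0 -normc_eq0; apply/negPn/negP => lm.
have e0 : 0 < normc (l - m) / 2 by rewrite divr_gt0// lt_def lm normc_ge0.
have [n1 H1] := ul _ e0; have [n2 H2] := um _ e0.
have := H1 _ (leq_maxl n1 n2); have := H2 _ (leq_maxr n1 n2).
have := le_normcD (l - u (maxn n1 n2)) (u (maxn n1 n2) - m).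
by rewrite addrA subrK [normc (l - u _)]normcB; lra.
Qed.

Lemma tends_cst l : tends (fun=> l) l.
Proof. by move=> e e0; exists 0%N => n _; rewrite subrr normc0. Qed.

Lemma tends_eq u v l : (forall n, u n = v n) -> tends u l -> tends v l.
Proof. by move=> uv H e /H[n0 Hn]; exists n0 => n /Hn; rewrite uv. Qed.

Lemma tendsD u v l m : tends u l -> tends v m -> tends (fun n => u n + v n) (l + m).
Proof.
move=> ul vm e e0; have e2 : 0 < e / 2 by rewrite divr_gt0.
have [n1 H1] := ul _ e2; have [n2 H2] := vm _ e2; exists (maxn n1 n2) => n.
rewrite geq_max => /andP[/H1 h1 /H2 h2].
have -> : u n + v n - (l + m) = (u n - l) + (v n - m) by ring.
by apply: le_lt_trans (le_normcD _ _) _; lra.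
Qed.

Lemma tendsM c u l : tends u l -> tends (fun n => c * u n) (c * l).
Proof.
move=> ul e e0; have c0 : 0 < normc c + 1 by have := normc_ge0 c; lra.
have [n0 H] := ul _ (divr_gt0 e0 c0); exists n0 => n /H.
rewrite ltr_pdivlMr// -mulrBr normcM; have := normc_ge0 (u n - l).
by lra.
Qed.

Lemma tends_shift u l : tends u l -> tends (fun n => u n.+1) l.
Proof. by move=> ul e /ul[n0 H]; exists n0 => n n0n; apply: H; rewrite leqW. Qed.

Lemma tends_le u l (M : R) : tends u l -> (forall n, normc (u n) <= M) -> normc l <= M.
Proof.
move=> ul uM; rewrite leNgt; apply/negP => Ml; rewrite -subr_gt0 in Ml.
have [n0 /(_ n0 (leqnn _))] := ul _ Ml; have := uM n0.
have := normcD_ge l (u n0 - l); rewrite [l + _]addrC subrK; lra.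
Qed.

Lemma tends_ReIm u (x y : R) :
  (fun n => Re (u n)) @ \oo --> x -> (fun n => Im (u n)) @ \oo --> y ->
  tends u (x +i* y).
Proof.
move=> /cvgrPdist_lt Hx /cvgrPdist_lt Hy e e0; have e2 : 0 < e / 2 by lra.
have [n1 _ H1] := Hx _ e2; have [n2 _ H2] := Hy _ e2; exists (maxn n1 n2) => n.
rewrite geq_max => /andP[/H1 /= h1 /H2 /= h2].
apply: le_lt_trans (normc_le_ReIm _) _; rewrite cReD cImD cReN cImN /=.
by rewrite distrC in h1; rewrite distrC in h2; lra.
Qed.

Lemma tends_bounded (u : nat -> R[i]) l : tends u l ->
  exists M, forall n, normc (u n) <= M.
Proof.
move=> /(_ _ ltr01)[n0 H].
exists (\sum_(k < n0) normc (u k) + (normc l + 1)) => n.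
have sum_ge0 : 0 <= \sum_(k < n0) normc (u k) by rewrite sumr_ge0// => i _; exact: normc_ge0.
have [nn|nn] := leqP n0 n.
  have := H _ nn; have := le_normcD (u n - l) l; rewrite subrK.
  by lra.
rewrite (bigD1 (Ordinal nn))//= -addrA lerDl.
rewrite addr_ge0 ?sumr_ge0//; first by move=> i _; exact: normc_ge0.
by have := normc_ge0 l; lra.
Qed.

End Limits.

(** * Taylor expansions of a power series inside its disc of convergence *)

Section PowerSeries.
Variable R : realType.
Implicit Types (a : nat -> R[i]) (q : R[i]) (s M : R).

Definition psums a q n := \sum_(0 <= k < n) a k * q ^+ k.

(* Cauchy's condition for a radius of convergence at least [s]. *)
Definition radius_ge a s := 0 < s /\ exists M, forall k, normc (a k) * s ^+ k <= M.

Definition psum a q : R[i] := xget 0 [set l | tends (psums a q) l].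

Lemma psumE a q l : tends (psums a q) l -> psum a q = l.
Proof. by move=> H; apply: xget_unique => // m Hm; apply: tends_unique H. Qed.

Lemma radius_bound_ge0 a s M : (forall k, normc (a k) * s ^+ k <= M) -> 0 <= M.
Proof. by move=> /(_ 0%N); apply: le_trans; rewrite expr0 mulr1 normc_ge0. Qed.

Lemma term_le a q s M k : 0 < s -> (forall k, normc (a k) * s ^+ k <= M) ->
  normc (a k * q ^+ k) <= M * (normc q / s) ^+ k.
Proof.
move=> s0 /(_ k) H; rewrite normcM normcX expr_div_n mulrA.
rewrite ler_pdivlMr ?exprn_gt0// mulrAC ler_wpM2r// exprn_ge0 ?normc_ge0//.
Qed.

Lemma psums_le a q s M n : normc q < s -> (forall k, normc (a k) * s ^+ k <= M) ->
  normc (psums a q n) <= M / (1 - normc q / s).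
Proof.
move=> qs H; have s0 : 0 < s := le_lt_trans (normc_ge0 _) qs.
have M0 := radius_bound_ge0 H.
set r := normc q / s; have r1 : r < 1 by rewrite ltr_pdivrMr// mul1r.
have r0 : 0 <= r by rewrite divr_ge0 ?normc_ge0// ltW.
rewrite ler_pdivlMr ?subr_gt0//.
(* The bound is sharpened to the finite geometric sum, so that it can be proved by induction. *)
apply: (@le_trans _ _ (M * (1 - r ^+ n))); last first.
  by rewrite ler_piMr// gerBl exprn_ge0.
elim: n => [|n IH].
  by rewrite /psums big_geq// normc0 mul0r expr0 subrr mulr0.
rewrite /psums big_nat_recr//= -/(psums a q n).
have := term_le q n s0 H; rewrite -/r => H1.
have H2 := le_normcD (psums a q n) (a n * q ^+ n).
have r2 : 0 < 1 - r by rewrite subr_gt0.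
have H3 : normc (psums a q n + a n * q ^+ n) * (1 - r) <=
   (normc (psums a q n) + normc (a n * q ^+ n)) * (1 - r) by rewrite ler_pM2r.
have H4 : normc (a n * q ^+ n) * (1 - r) <= M * r ^+ n * (1 - r) by rewrite ler_pM2r.
by rewrite exprS; lra.
Qed.

(** A geometric series dominates the terms, so the series of real parts and of imaginary parts both
    converge. *)
Lemma psum_tends a q s : radius_ge a s -> normc q < s ->
  tends (psums a q) (psum a q).
Proof.
move=> [s0 [M H]] qs; pose u k := a k * q ^+ k.
have r01 : `|normc q / s| < 1.
  by rewrite ger0_norm ?divr_ge0 ?normc_ge0// ?ltW// ltr_pdivrMr// mul1r.
have cvgp (f : R[i] -> R) : (forall z, `|f z| <= normc z) ->
    cvgn (series (fun k => f (u k))).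
  move=> fle; apply: normed_cvg.
  apply: series_le_cvg (@is_cvg_geometric_series _ M _ r01) => //= n.
  - by rewrite mulr_ge0 ?(radius_bound_ge0 H)// exprn_ge0// divr_ge0 ?normc_ge0 ?ltW.
  - by apply: le_trans (fle _) _; exact: term_le.
have cr := cvgp _ (@Re_le_normc R); have ci := cvgp _ (@Im_le_normc R).
have sE (f : R[i] -> R) : (forall x y, f (x + y) = f x + f y) -> f 0 = 0 ->
   (fun n => f (psums a q n)) = series (fun k => f (u k)).
  by move=> fD f0; apply/funext => n; rewrite /psums /series /=; apply: big_morph.
suff [l Hl] : exists l, tends (psums a q) l by rewrite (psumE Hl).
eexists; apply: tends_ReIm.
  by rewrite (sE _ (@cReD R) erefl); exact: cr.
by rewrite (sE _ (@cImD R) erefl); exact: ci.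
Qed.

Lemma radius_shift a s m : radius_ge a s -> radius_ge (fun k => a (m + k)%N) s.
Proof.
move=> [s0 [M H]]; split=> //; exists (M / s ^+ m) => k.
by rewrite ler_pdivlMr ?exprn_gt0// -mulrA -exprD addnC.
Qed.

Lemma psum_shift a s q m : radius_ge a s -> normc q < s ->
  psum (fun k => a (m + k)%N) q = a m + q * psum (fun k => a (m.+1 + k)%N) q.
Proof.
move=> Ha qs; apply: tends_unique (tends_shift (psum_tends (radius_shift m Ha) qs)) _.
apply: tends_eq (tendsD (tends_cst (a m))
  (tendsM q (psum_tends (radius_shift m.+1 Ha) qs))) => n.
rewrite /psums big_nat_recl// addn0 expr0 mulr1; congr (_ + _).
rewrite big_distrr /=; apply: eq_bigr => k _.
by rewrite addnS exprS; ring.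
Qed.

(* The coefficients of [(psum a x - psum a q) / (x - q)]. *)
Definition divided a q k := psum (fun i => a (k.+1 + i)%N) q.

Lemma radius_divided a q s : radius_ge a s -> normc q < s ->
  radius_ge (divided a q) s.
Proof.
move=> Ha qs; have [s0 [M H]] := Ha; split=> //.
exists (M / s / (1 - normc q / s)) => k.
have Hk := radius_shift k.+1 Ha.
have := tends_le (psum_tends Hk qs) (fun n => psums_le n qs _).
move=> /(_ (M / s ^+ k.+1)) H1.
rewrite -ler_pdivlMr ?exprn_gt0//; apply: le_trans (H1 _) _.
  by move=> i; rewrite ler_pdivlMr ?exprn_gt0// -mulrA -exprD addnC.
by rewrite le_eqVlt exprS invfM; apply/orP; left; apply/eqP; ring.
Qed.

(** The tails [B k] satisfy [B k = a k + q * B k.+1], so the partial sums of the product telescope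
    ([E]), up to a term [B n * x ^+ n] that tends to 0. *)
Lemma psum_divided a q s x : radius_ge a s -> normc q < s -> normc x < s ->
  psum a x = psum a q + (x - q) * psum (divided a q) x.
Proof.
move=> Ha qs xs.
pose B k := psum (fun i => a (k + i)%N) q.
have BS k : B k = a k + q * B k.+1 by rewrite /B (psum_shift _ Ha qs).
have E n : (x - q) * psums (divided a q) x n = psums a x n - B 0%N + B n * x ^+ n.
  elim: n => [|n IH]; first by rewrite /psums !big_geq//; ring.
  rewrite /psums !big_nat_recr//= -!/(psums _ _ _) mulrDr IH /divided -/(B n.+1).
  by rewrite (BS n) exprS; ring.
have [_ [M HM]] := radius_divided Ha qs; have [s0 _] := Ha.
have Bx : tends (fun n => B n * x ^+ n) 0.
  move=> e e0; have r01 : 0 <= normc x / s < 1.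
    by rewrite divr_ge0 ?normc_ge0 ?(ltW s0)//= ltr_pdivrMr// mul1r.
  have [n0 Hn] := expr_small (M * normc x) r01 e0.
  exists n0.+1 => -[//|n] nn; rewrite subr0 exprS mulrCA normcM.
  apply: le_lt_trans (Hn n nn); rewrite mulrC [leRHS]mulrAC.
  rewrite ler_wpM2r ?normc_ge0//.
  exact: (@term_le (divided a q)).
have -> : psum a q = B 0%N by [].
have H1 := tendsD (tendsD (psum_tends Ha xs) (tends_cst (- B 0%N))) Bx.
have H2 := tendsM (x - q) (psum_tends (radius_divided Ha qs) xs).
have := tends_unique (tends_eq (fun n => E n) H2) H1 => ->.
by ring.
Qed.

Lemma psum_bounded a q s : radius_ge a s -> normc q < s ->
  bigO 0 (fun w => psum a (q + w)).
Proof.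
move=> Ha qs; have [s0 [M H]] := Ha.
pose t := (s - normc q) / 2.
have t0 : 0 < t by rewrite divr_gt0// subr_gt0.
have M0 := radius_bound_ge0 H.
exists (M / (1 - (normc q + t) / s)).
exists t => // w wt; rewrite expr0 mulr1.
have qwt : normc (q + w) <= normc q + t.
  by apply: le_trans (le_normcD _ _) _; lra.
have qts : normc q + t < s by rewrite /t; lra.
have qws := le_lt_trans qwt qts.
apply: le_trans (tends_le (psum_tends Ha qws) (fun n => psums_le n qws H)) _.
rewrite ler_wpM2l// lef_pV2 ?posrE ?subr_gt0 ?ltr_pdivrMr ?mul1r//.
by rewrite lerB// ler_pM2r// invr_gt0.
Qed.

(** [psum_divided] gains one factor [w] and leaves a power series with the same radius, so its
    iteration reaches every order. *)
Lemma taylor_psum a q s : radius_ge a s -> normc q < s -> taylor (psum a) q.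
Proof.
move=> Ha qs n; elim: n a Ha => [|n IH] a Ha.
  exists 0; apply: bigO_eq (psum_bounded Ha qs) => w.
  by rewrite horner0 subr0.
have [p Hp] := IH _ (radius_divided Ha qs).
exists ((psum a q)%:P + 'X * p).
have sq : 0 < s - normc q by rewrite subr_gt0.
have := bigOM (@bigO_id R) Hp; rewrite add1n; apply: bigO_near.
apply: near0W (near0_lt sq) => w ws.
have qws : normc (q + w) < s by apply: le_lt_trans (le_normcD _ _) _; lra.
rewrite (psum_divided Ha qs qws) hornerD hornerC hornerM hornerX.
by rewrite [q + w - q]addrC addKr; ring.
Qed.

End PowerSeries.

(** * The exponential and the nome *)

Section Exponential.
Variable R : realType.
Implicit Types (w z : R[i]) (p : {poly R[i]}).

Lemma cexpD z w : cexp (z + w) = cexp z * cexp w.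
Proof.
rewrite /cexp cReD cImD expRD cosD sinD rmorphM /=.
rewrite mulrACA; congr (_ * _); simpc; congr (_ +i* _); ring.
Qed.

Lemma cexp0 : cexp 0 = 1 :> R[i].
Proof. by rewrite /cexp /= expR0 cos0 sin0 mul1r. Qed.

Lemma normc_cexp w : normc (cexp w) = expR (Re w).
Proof.
have circle (x : R) : normc (cos x +i* sin x) = 1.
  by rewrite /normc /= cos2Dsin2 sqrtr1.
by rewrite /cexp normcM normc_real ger0_norm ?expR_ge0// circle mulr1.
Qed.

(** Differentiating real and imaginary parts along the ray [t * w] makes the real mean value theorem
    available for complex functions. *)
Lemma is_derive_ray p w (t : R) :
  is_derive t 1 (fun t : R => Re p.[t%:C * w]) (Re (w * p^`().[t%:C * w])) /\
  is_derive t 1 (fun t : R => Im p.[t%:C * w]) (Im (w * p^`().[t%:C * w])).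
Proof.
elim/poly_ind: p => [|p c [IHr IHi]].
  rewrite deriv0 horner0 mulr0 /=.
  by split; (under eq_fun do rewrite horner0 /=); exact: is_derive_cst.
have lin (u : R) : is_derive t 1 (fun t : R => t * u) u.
  by apply: is_derive_eq; rewrite scaler0 add0r; exact: mulr1.
have := is_deriveB (is_deriveM IHr (lin (Re w))) (is_deriveM IHi (lin (Im w))).
have := is_deriveD (is_deriveM IHr (lin (Im w))) (is_deriveM IHi (lin (Re w))).
move=> Hi Hr; split.
- have := is_deriveD Hr (is_derive_cst (Re c) t 1).
  rewrite [X in is_derive _ _ X _](_ : _ = (fun t : R => Re (p * 'X + c%:P).[t%:C * w])); last first.
    by apply/funext => x; rewrite hornerMXaddC !(cReD, cReM, cImM) /= !fctE; ring.
  move=> /is_derive_eq; apply.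
  rewrite derivMXaddC hornerD hornerMX !(cReD, cImD, cReM, cImM) /GRing.scale /=.
  by ring.
- have := is_deriveD Hi (is_derive_cst (Im c) t 1).
  rewrite [X in is_derive _ _ X _](_ : _ = (fun t : R => Im (p * 'X + c%:P).[t%:C * w])); last first.
    by apply/funext => x; rewrite hornerMXaddC !(cImD, cReM, cImM) /= !fctE; ring.
  move=> /is_derive_eq; apply.
  rewrite derivMXaddC hornerD hornerMX !(cReD, cImD, cReM, cImM) /GRing.scale /=.
  by ring.
Qed.

Lemma is_derive_cexp_ray w (t : R) :
  is_derive t 1 (fun t : R => Re (cexp (t%:C * w))) (Re (w * cexp (t%:C * w))) /\
  is_derive t 1 (fun t : R => Im (cexp (t%:C * w))) (Im (w * cexp (t%:C * w))).
Proof.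
have lin (u : R) : is_derive t 1 (fun t : R => t * u) u.
  by apply: is_derive_eq; rewrite scaler0 add0r; exact: mulr1.
have He := is_derive1_comp (is_derive_expR _) (lin (Re w)).
have Hc := is_derive1_comp (is_derive_cos _) (lin (Im w)).
have Hs := is_derive1_comp (is_derive_sin _) (lin (Im w)).
split.
- have := is_deriveM He Hc.
  rewrite [X in is_derive _ _ X _](_ : _ = (fun t : R => Re (cexp (t%:C * w)))); last first.
    by apply/funext => x; rewrite /cexp !(cReM, cImM) /= !fctE /= !mul0r !subr0 !addr0.
  move=> /is_derive_eq; apply.
  by rewrite /cexp !(cReM, cImM) /GRing.scale /= !mul0r !subr0 !addr0; ring.
- have := is_deriveM He Hs.
  rewrite [X in is_derive _ _ X _](_ : _ = (fun t : R => Im (cexp (t%:C * w)))); last first.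
    by apply/funext => x; rewrite /cexp !(cReM, cImM) /= !fctE /= !mul0r !subr0 !addr0.
  move=> /is_derive_eq; apply.
  by rewrite /cexp !(cReM, cImM) /GRing.scale /= !mul0r !subr0 !addr0; ring.
Qed.

Definition exp_poly n : {poly R[i]} := \poly_(k < n) (k`!%:R)^-1.

Lemma deriv_exp_poly n : (exp_poly n.+1)^`() = exp_poly n.
Proof.
apply/polyP => k; rewrite coef_deriv !coef_poly ltnS; case: ifP => _; last by rewrite mul0rn.
by rewrite factS natrM invfM -mulrnAl -[k.+1%:R^-1 *+ _]mulr_natr mulVf ?mul1r// pnatr_eq0.
Qed.

(** The derivative of the error of index [n.+1] along the ray through [w] is [w] times the error of
    index [n]. The mean value theorem is applied to the real and the imaginary part, whence the
    constant [K + K]. *)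
Lemma exp_poly_le n : exists K, forall w, normc w <= 1 ->
  normc (cexp w - (exp_poly n).[w]) <= K * normc w ^+ n.
Proof.
elim: n => [|n [K HK]].
  exists (expR 1) => w w1; rewrite /exp_poly horner_poly big_ord0 subr0.
  rewrite expr0 mulr1 normc_cexp ler_expR.
  by apply: le_trans w1; apply: le_trans (Re_le_normc _); exact: ler_norm.
exists (K + K) => w w1.
pose D n (t : R) := cexp (t%:C * w) - (exp_poly n).[t%:C * w].
have D0 : D n.+1 0 = 0.
  by rewrite /D mul0r cexp0 horner_coef0 coef_poly /= fact0 invr1 subrr.
have bnd (t : R) : t \in `]0, 1[%R -> normc (w * D n t) <= K * normc w ^+ n.+1.
  rewrite in_itv /= => /andP[t0 t1]; rewrite normcM exprS mulrCA.
  rewrite ler_wpM2l ?normc_ge0//.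
  have K0 : 0 <= K.
    have := HK 1; rewrite normc1 lexx => /(_ isT); rewrite expr1n mulr1.
    by apply: le_trans; exact: normc_ge0.
  have tw : normc (t%:C * w) <= normc w.
    by rewrite normcM normc_real gtr0_norm// ler_piMl ?normc_ge0// ltW.
  apply: le_trans (HK _ (le_trans tw w1)) _.
  by rewrite ler_wpM2l// lerXn2r ?nnegrE ?normc_ge0.
have dr (t : R) : is_derive t 1 (fun t : R => Re (D n.+1 t)) (Re (w * D n t)).
  have [H1 _] := is_derive_cexp_ray w t; have [H2 _] := is_derive_ray (exp_poly n.+1) w t.
  have := is_deriveB H1 H2.
  rewrite [X in is_derive _ _ X _](_ : _ = (fun t : R => Re (D n.+1 t))); last first.
    by apply/funext => x; rewrite /D cReD cReN.
  by move=> /is_derive_eq; apply; rewrite deriv_exp_poly /D mulrBr cReD cReN.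
have di (t : R) : is_derive t 1 (fun t : R => Im (D n.+1 t)) (Im (w * D n t)).
  have [_ H1] := is_derive_cexp_ray w t; have [_ H2] := is_derive_ray (exp_poly n.+1) w t.
  have := is_deriveB H1 H2.
  rewrite [X in is_derive _ _ X _](_ : _ = (fun t : R => Im (D n.+1 t))); last first.
    by apply/funext => x; rewrite /D cImD cImN.
  by move=> /is_derive_eq; apply; rewrite deriv_exp_poly /D mulrBr cImD cImN.
have cont (f df : R -> R) : (forall t : R, is_derive t 1 f (df t)) ->
    {within `[0, 1], continuous f}.
  move=> H; apply: continuous_subspaceT => t.
  by apply/differentiable_continuous/derivable1_diffP; have [] := H t.
have D1 : D n.+1 1 = cexp w - (exp_poly n.+1).[w] by rewrite /D mul1r.
rewrite -D1 mulrDl; apply: le_trans (normc_le_ReIm _) _; apply: lerD.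
- have [t t01] := MVT ltr01 (fun x _ => dr x) (cont _ _ dr).
  rewrite D0 subr0 subr0 mulr1 => ->.
  by apply: le_trans (Re_le_normc _) _; exact: bnd.
- have [t t01] := MVT ltr01 (fun x _ => di x) (cont _ _ di).
  rewrite D0 subr0 subr0 mulr1 => ->.
  by apply: le_trans (Im_le_normc _) _; exact: bnd.
Qed.

Lemma taylor_cexp z : taylor (@cexp R) z.
Proof.
move=> n; exists (cexp z *: exp_poly n); have [K HK] := exp_poly_le n.
have HO : bigO n (fun w => cexp w - (exp_poly n).[w]).
  by exists K; apply: near0W (near0_lt ltr01) => w /ltW /HK.
by apply: bigO_eq (bigOM (bigO_cst (cexp z)) HO) => w; rewrite cexpD hornerZ; ring.
Qed.

Lemma taylor_nome z : taylor (@nome R) z.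
Proof.
apply: (@taylor_comp _ (@cexp R) (fun z => 2 * pi%:C * 'i * z)); last exact: taylor_cexp.
by apply: taylorM; [exact: taylor_cst|exact: taylor_id].
Qed.

Lemma normc_nome z : normc (nome z) = expR (- (2 * pi * Im z)).
Proof.
rewrite /nome normc_cexp; congr expR.
by case: z => x y; rewrite !(cReM, cImM) /=; ring.
Qed.

Lemma normc_nome_gt0 z : 0 < normc (nome z).
Proof. by rewrite normc_nome expR_gt0. Qed.

Lemma normc_nome_lt1 z : 0 < Im z -> normc (nome z) < 1.
Proof.
move=> z0; rewrite normc_nome -expR0 ltr_expR oppr_lt0.
by rewrite !mulr_gt0// pi_gt0.
Qed.

(** Polar coordinates: with [t] an argument of [q], a preimage is
    [(t - 'i * ln (normc q)) / (2 * pi)]. The function [acos] gives [t] up to a sign, which is that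
    of [Im q]. *)
Lemma nome_surj (q : R[i]) : q != 0 -> normc q < 1 ->
  exists2 z, 0 < Im z & nome z = q.
Proof.
move=> q0 q1; have nq : 0 < normc q by rewrite normc_gt0.
have [t [ct st]] : exists t : R, Re q = normc q * cos t /\ Im q = normc q * sin t.
  have qn := normc_sqr q.
  have Rq : -1 <= Re q / normc q <= 1.
    have := Re_le_normc q; rewrite ler_norml => /andP[? ?].
    by rewrite ler_pdivlMr// ler_pdivrMr//; lra.
  have cK := acosK Rq.
  have sE : normc q * sin (acos (Re q / normc q)) = `|Im q|.
    rewrite sin_acos//; apply/eqP; rewrite -(@eqrXn2 _ 2)//; last first.
      by rewrite mulr_ge0 ?normc_ge0// sqrtr_ge0.
    rewrite exprMn sqr_sqrtr; last first.
      rewrite subr_ge0 -ler_sqrt ?ltr01// sqrtr_sqr sqrtr1 ler_norml.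
      exact: Rq.
    have -> : normc q ^+ 2 * (1 - (Re q / normc q) ^+ 2) = normc q ^+ 2 - Re q ^+ 2.
      by field; rewrite gt_eqF.
    by rewrite qn addrC addKr real_normK ?num_real.
  have [i0|i0] := leP 0 (Im q).
    exists (acos (Re q / normc q)); rewrite cK mulrC divfK ?gt_eqF//.
    by rewrite sE ger0_norm.
  exists (- acos (Re q / normc q)); rewrite cosN cK mulrC divfK ?gt_eqF//.
  by rewrite sinN mulrN sE ltr0_norm// opprK.
have p0 : 2 * pi != 0 :> R by rewrite mulf_neq0// gt_eqF// pi_gt0.
exists ((t / (2 * pi)) +i* (- ln (normc q) / (2 * pi))).
  by rewrite /= divr_gt0 ?mulr_gt0 ?pi_gt0// oppr_gt0 ln_lt0// nq.
rewrite /nome /cexp.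
have -> : 2 * pi%:C * 'i * ((t / (2 * pi)) +i* (- ln (normc q) / (2 * pi))) =
    ln (normc q) +i* t.
  have -> : 2 * pi%:C = (2 * pi)%:C :> R[i] by rewrite rmorphM /= rmorph_nat.
  apply/eqP; rewrite eq_complex !(cReM, cImM) /=.
  rewrite !mulr0 !mul0r subr0 mulr1 addr0 mul0r !add0r mulNr mulrN opprK.
  by rewrite mul0r add0r !(mulrC (2 * pi)) !divfK ?eqxx.
rewrite /= lnK ?posrE//; apply/eqP; rewrite eq_complex !(cReM, cImM) /= !mul0r subr0 addr0.
by rewrite -ct -st !eqxx.
Qed.

End Exponential.

(** * Surjectivity of j *)

Section ModularJ.
Variables (R : realType) (j : R[i] -> R[i]).
Hypothesis hj : is_modular_j j.

(** Every [s] in []0, 1[] is itself a nome, so the expansion converges there. Its partial sums are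
    then bounded, and so are its terms, as differences of consecutive partial sums. *)
Lemma j_q_expansion : exists a, (forall s, 0 < s < 1 -> radius_ge a s) /\
  forall z, 0 < Im z -> j z = (nome z)^-1 + psum a (nome z).
Proof.
have [_ _ [a [_ Ha]]] := hj; exists a.
have T z : 0 < Im z -> tends (psums a (nome z)) (j z - (nome z)^-1).
  move=> z0; have H := cvg_tends (Ha z z0).
  apply: tends_eq (_ : tends (fun n => _ + - (nome z)^-1) _); last first.
    exact: tendsD H (tends_cst _).
  by move=> n; rewrite /= addrC addKr.
split=> [s /andP[s0 s1]|z z0]; last by rewrite (psumE (T z z0)) addrC subrK.
split=> //.
have sC : s%:C != 0 :> R[i] by rewrite -normc_gt0 normc_real gtr0_norm.
have [|z z0 zs] := nome_surj sC; first by rewrite normc_real gtr0_norm.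
have [M HM] := tends_bounded (T z z0); exists (M + M) => k.
have -> : normc (a k) * s ^+ k = normc (psums a (nome z) k.+1 - psums a (nome z) k).
  rewrite /psums big_nat_recr//= [_ + a k * _]addrC addrK zs normcM normcX.
  by rewrite normc_real gtr0_norm.
apply: le_trans (le_normcD _ _) _; rewrite normcN.
exact: lerD.
Qed.

Lemma taylor_j z : 0 < Im z -> taylor j z.
Proof.
move=> z0; have [a [Ha ja]] := j_q_expansion.
have q0 : nome z != 0 by rewrite -normc_gt0 normc_nome_gt0.
have H : taylor (fun z => (nome z)^-1 + psum a (nome z)) z.
  apply: taylorD; first by apply: taylorV q0; exact: taylor_nome.
  apply: taylor_comp; first exact: taylor_nome.
  have q1 := normc_nome_lt1 z0; have q2 := normc_nome_gt0 z.
  apply: (@taylor_psum _ _ _ ((1 + normc (nome z)) / 2)); last by lra.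
  by apply: Ha; lra.
apply: taylor_near H; exists (Im z) => // w wz.
rewrite ja// cImD; have := Im_le_normc w; rewrite ler_norml => /andP[? _].
by lra.
Qed.

Lemma j_SL2Z (a b c d : int) z : a * d - b * c = 1 -> 0 < Im z ->
  j ((a%:~R * z + b%:~R) / (c%:~R * z + d%:~R)) = j z.
Proof. by move=> abcd z0; have [_ H _] := hj; exact: H. Qed.

Lemma j_opp_inv z : 0 < Im z -> j (- z^-1) = j z.
Proof.
move=> z0; have := @j_SL2Z 0 (-1) 1 0 z erefl z0.
by rewrite mul0r add0r addr0 mul1r mulN1r.
Qed.

Lemma j_addz (m : int) z : 0 < Im z -> j (z + m%:~R) = j z.
Proof.
move=> z0; have := @j_SL2Z 1 m 0 1 z; rewrite !mulr1 mulr0 subr0 => /(_ erefl z0).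
by rewrite mul0r add0r invr1 mulr1 mul1r.
Qed.

(* If [|Re z| <= 1/2] and [Im z < 1/2] then [|z|^2 <= 1/2], so [z |-> -1/z]
   at least doubles the imaginary part. *)
Lemma j_reduction z : 0 < Im z ->
  exists2 z', j z' = j z & 2^-1 <= Im z'.
Proof.
(* The induction is on the number of doublings that suffice to bring the imaginary part up to
   [1 / 2]. *)
move=> z0; have [n] : exists n, 2^-1 <= Im z * 2 ^+ n.
  have half : 0 <= (2^-1 : R) < 1 by lra.
  have [n /(_ n (leqnn _)) H] := expr_small 1 half z0; exists n.
  rewrite mul1r exprVn -[X in X < _]div1r ltr_pdivrMr ?exprn_gt0// in H.
  by apply: le_trans (ltW H); lra.
elim: n z z0 => [|n IH] z z0 zn; first by exists z => //; rewrite expr0 mulr1 in zn.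
have [zh|zh] := leP (2^-1) (Im z); first by exists z.
pose m := Num.floor (Re z + 2^-1).
pose z1 := z + (- m)%:~R.
have z1i : Im z1 = Im z by rewrite cImD Im_intr addr0.
have z1r : - 2^-1 <= Re z1 <= 2^-1.
  rewrite cReD Re_intr rmorphN /=; have := floor_itv (Re z + 2^-1).
  rewrite -/m intrD => /andP[? ?]; lra.
have z10 : 0 < Im z1 by rewrite z1i.
have nz1 : 0 < normc z1 ^+ 2.
  by rewrite exprn_gt0// (lt_le_trans z10)// (le_trans (ler_norm _))// Im_le_normc.
have nz2 : normc z1 ^+ 2 <= 2^-1 by rewrite normc_sqr; nra.
pose z2 := - z1^-1.
have z2i : Im z1 * 2 <= Im z2.
  rewrite /z2 cImN Im_inv mulNr opprK ler_pdivlMr// -mulrA ler_piMr ?(ltW z10)//.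
  by lra.
have [||z' jz' z'h] := IH z2; first by lra.
  apply: le_trans zn _; rewrite exprS mulrA ler_pM2r ?exprn_gt0//.
  by rewrite -z1i.
exists z' => //; rewrite jz' j_opp_inv//.
exact: j_addz.
Qed.

(* If [j] omits [c] then [psi q = 1 / (q (j - c))] is analytic on the unit disc.
   As [|psi q| |q| = 1 / |j - c|] takes all its values on a smaller disc
   [|q| <= s], the maximum modulus principle on a disc between the two is
   violated. *)
Lemma j_surj c : exists2 z, 0 < Im z & j z = c.
Proof.
have [//|nc] := pselect (exists2 z, 0 < Im z & j z = c).
have {}nc z : 0 < Im z -> j z - c != 0.
  by move=> z0; rewrite subr_eq0; apply/eqP => jz; apply: nc; exists z.
have [a [Ha ja]] := j_q_expansion.
(* This is [q * (j - c)] with the pole of [j] cancelled; at [q = 0] it takes the value 1. *)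
pose h q := 1 + q * (psum a q - c).
have hE z : 0 < Im z -> h (nome z) = nome z * (j z - c).
  move=> z0; have q0 : nome z != 0 by rewrite -normc_gt0 normc_nome_gt0.
  by rewrite ja// /h; field.
have h0 q : normc q < 1 -> h q != 0.
  move=> q1; have [->|q0] := eqVneq q 0; first by rewrite /h mul0r addr0 oner_eq0.
  have [z z0 <-] := nome_surj q0 q1.
  by rewrite hE// mulf_neq0 ?nc// -normc_gt0 normc_nome_gt0.
pose psi q := (h q)^-1.
have tpsi q : normc q < 1 -> taylor psi q.
  move=> q1; apply: taylorV; last exact: h0.
  apply: taylorD; first exact: taylor_cst.
  apply: taylorM; first exact: taylor_id.
  apply: taylorD; last exact: taylor_cst.
  have := normc_ge0 q => q0.
  by apply: (@taylor_psum _ _ _ ((1 + normc q) / 2)); [apply: Ha|]; lra.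
have psi0 q : normc q < 1 -> psi q != 0 by move=> /h0; rewrite invr_eq0.
have E x : 0 < Im x -> normc (psi (nome x)) * normc (nome x) = (normc (j x - c))^-1.
  move=> x0; rewrite /psi normcV hE// normcM invfM mulrAC mulVf ?mul1r//.
  by rewrite gt_eqF// normc_nome_gt0.
clearbody psi.
(* The modulus of the nome at height [1 / 2], the height guaranteed by [j_reduction]. *)
have [s [s0 s1 sE]] : exists s : R, [/\ 0 < s, s < 1 & s = expR (- pi)].
  exists (expR (- pi)); split=> //; first exact: expR_gt0.
  by rewrite -expR0 ltr_expR oppr_lt0 pi_gt0.
pose t := (1 + s) / 2.
have [q0 q0s q0max] : exists2 q0, normc (q0 - 0) <= s &
    forall q, normc (q - 0) <= s -> normc (psi q) <= normc (psi q0).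
  apply: disc_normc_max; first exact: ltW.
  by move=> q; rewrite subr0 => qs; apply: tpsi; exact: le_lt_trans s1.
set A := normc (psi q0).
have A0 : 0 < A by rewrite normc_gt0 psi0// -[q0]subr0 (le_lt_trans q0s).
(* A point of the circle has the same [j] value as some nome in the disc of radius [s], where
   [normc (psi q) * normc q] is at most [A * s]; by [E] this product depends on the [j] value
   only. *)
have circ q : normc (q - 0) = t -> normc (psi q) <= A * s / t.
  rewrite subr0 => qt; have t0 : 0 < t by rewrite /t; lra.
  have t1 : t < 1 by rewrite /t; lra.
  have qn : q != 0 by rewrite -normc_gt0 qt.
  have q1 : normc q < 1 by rewrite qt.
  have [z z0 zq] := nome_surj qn q1.
  have [z' jz' z'h] := j_reduction z0.
  have z'0 : 0 < Im z' by lra.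
  have z's : normc (nome z') <= s.
    rewrite sE normc_nome ler_expR lerN2 -[leLHS]mul1r mulrAC ler_pM2r ?pi_gt0//.
    by lra.
  have Eq : normc (psi q) * t = normc (psi (nome z')) * normc (nome z').
    by rewrite (E z' z'0) jz' -(E z z0) zq qt.
  have Az' : normc (psi (nome z')) <= A by apply: q0max; rewrite subr0.
  rewrite (ler_pdivlMr _ _ t0) Eq.
  exact: (ler_pM (normc_ge0 _) (normc_ge0 _) Az' z's).
have : A <= A * s / t.
  apply: (maximum_modulus _ circ); last by apply: le_trans q0s _; rewrite /t; lra.
  by move=> q; rewrite subr0 => qt; apply: tpsi; apply: le_lt_trans qt _; rewrite /t; lra.
rewrite ler_pdivlMr; last by rewrite /t; lra.
by rewrite ler_pM2l// /t; lra.
Qed.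

End ModularJ.

(** * Polynomial functions *)

Section PolynomialFunctions.
Variable R : realType.
Local Notation C := R[i].

(** A class of functions rather than a polynomial ring: fixing the first variable stays inside it,
    and analytic properties follow by induction on the construction. *)
Inductive polyfun n : (('I_n -> C) -> C) -> Prop :=
| polyfun_cst c : polyfun (fun=> c)
| polyfun_proj i : polyfun (fun v => v i)
| polyfunD F G : polyfun F -> polyfun G -> polyfun (fun v => F v + G v)
| polyfunM F G : polyfun F -> polyfun G -> polyfun (fun v => F v * G v).

Lemma polyfun_eq n (F G : ('I_n -> C) -> C) : F =1 G -> polyfun F -> polyfun G.
Proof. by move=> /funext ->. Qed.

Lemma polyfun_meval n (p : mpoly n C) : polyfun (fun v => meval v p).
Proof.
elim/mpolyind: p => [|c m p _ _ IH].
  by apply: polyfun_eq (polyfun_cst n 0) => v; rewrite meval0.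
have Hm : polyfun (fun v : 'I_n -> C => \prod_(i < n) v i ^+ m i).
  elim: (index_enum _) => [|i s IHs].
    by apply: polyfun_eq (polyfun_cst n 1) => v; rewrite big_nil.
  have Hi k : polyfun (fun v : 'I_n -> C => v i ^+ k).
    elim: k => [|k IHk]; first exact: polyfun_cst.
    by apply: polyfun_eq (polyfunM (polyfun_proj i) IHk) => v; rewrite exprS.
  by apply: polyfun_eq (polyfunM (Hi (m i)) IHs) => v; rewrite big_cons.
apply: polyfun_eq (polyfunD (polyfunM (polyfun_cst n c) Hm) IH) => v.
by rewrite mevalD mevalZ mevalX.
Qed.

Lemma taylor_polyfun n (F : ('I_n -> C) -> C) (v : C -> 'I_n -> C) z :
  polyfun F -> (forall i, taylor (fun x => v x i) z) ->
  taylor (fun x => F (v x)) z.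
Proof.
move=> + tv; elim=> [c|i|G H _ tG _ tH|G H _ tG _ tH] //.
- exact: taylor_cst.
- exact: taylorD.
- exact: taylorM.
Qed.

(** A single [L] serves as bound and as Lipschitz constant, because the induction step for products
    needs both for each factor. *)
Lemma polyfun_lipschitz n (F : ('I_n -> C) -> C) (B : R) : polyfun F ->
  exists2 L, 0 <= L & forall u v e, 0 <= e ->
    (forall i, normc (u i) <= B) -> (forall i, normc (v i) <= B) ->
    (forall i, normc (u i - v i) <= e) ->
    normc (F u) <= L /\ normc (F u - F v) <= L * e.
Proof.
elim=> [c|i|G H _ [L L0 HL] _ [M M0 HM]|G H _ [L L0 HL] _ [M M0 HM]].
- exists (normc c); first exact: normc_ge0.
  by move=> u v e e0 _ _ _; split => //; rewrite subrr normc0 mulr_ge0// normc_ge0.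
- exists (`|B| + 1); first by rewrite addr_ge0.
  move=> u v e e0 uB vB uv; split.
    by apply: le_trans (uB i) _; have := ler_norm B; lra.
  by apply: le_trans (uv i) _; rewrite ler_peMl//; have := normr_ge0 B; lra.
- exists (L + M); first exact: addr_ge0.
  move=> u v e e0 uB vB uv; have [G1 G2] := HL _ _ _ e0 uB vB uv.
  have [H1 H2] := HM _ _ _ e0 uB vB uv; split.
    by apply: le_trans (le_normcD _ _) _; exact: lerD.
  have -> : G u + H u - (G v + H v) = (G u - G v) + (H u - H v) by ring.
  by rewrite mulrDl; apply: le_trans (le_normcD _ _) _; exact: lerD.
- exists (L * M + L * M); first by rewrite addr_ge0// mulr_ge0.
  move=> u v e e0 uB vB uv; have [G1 G2] := HL _ _ _ e0 uB vB uv.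
  have [H1 H2] := HM _ _ _ e0 uB vB uv.
  have vu i : normc (v i - u i) <= e by rewrite normcB.
  have [H3 _] := HM _ _ _ e0 vB uB vu.
  have LM : 0 <= L * M by rewrite mulr_ge0.
  split.
    rewrite normcM; apply: (@le_trans _ _ (L * M)); last by lra.
    by apply: ler_pM; rewrite ?normc_ge0.
  have -> : G u * H u - G v * H v = (G u - G v) * H v + G u * (H u - H v) by ring.
  apply: le_trans (le_normcD _ _) _; rewrite !normcM.
  have E1 : normc (G u - G v) * normc (H v) <= (L * e) * M.
    by apply: ler_pM; rewrite ?normc_ge0.
  have E2 : normc (G u) * normc (H u - H v) <= L * (M * e).
    by apply: ler_pM; rewrite ?normc_ge0.
  lra.
Qed.

Lemma polyfun_poly n (F : ('I_n -> C) -> C) (v : 'I_n -> {poly C}) :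
  polyfun F -> exists P : {poly C}, forall x, F (fun i => (v i).[x]) = P.[x].
Proof.
elim=> [c|i|G H _ [p Hp] _ [q Hq]|G H _ [p Hp] _ [q Hq]].
- by exists c%:P => x; rewrite hornerC.
- by exists (v i).
- by exists (p + q) => x; rewrite hornerD Hp Hq.
- by exists (p * q) => x; rewrite hornerM Hp Hq.
Qed.

Definition fcons n (x : C) (y : 'I_n -> C) : 'I_n.+1 -> C :=
  fun k => if unlift ord0 k is Some i then y i else x.

Lemma polyfun_fcons n (F : ('I_n.+1 -> C) -> C) x :
  polyfun F -> polyfun (fun y : 'I_n -> C => F (fcons x y)).
Proof.
elim=> [c|k|G H _ HG _ HH|G H _ HG _ HH].
- exact: polyfun_cst.
- rewrite /fcons; case: (unlift ord0 k) => [i|]; last exact: polyfun_cst.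
  exact: polyfun_proj.
- exact: polyfunD.
- exact: polyfunM.
Qed.

Lemma polyfun_fcons_poly n (F : ('I_n.+1 -> C) -> C) (y : 'I_n -> C) :
  polyfun F -> exists P : {poly C}, forall x, F (fcons x y) = P.[x].
Proof.
move=> /(@polyfun_poly _ _ (fun k => if unlift ord0 k is Some i then (y i)%:P else 'X)).
case=> P HP; exists P => x; rewrite -HP; congr F; apply/funext => k.
by rewrite /fcons; case: (unlift ord0 k) => [i|]; rewrite ?hornerC ?hornerX.
Qed.

Lemma fcons_eta n (v : 'I_n.+1 -> C) : v = fcons (v ord0) (fun i => v (lift ord0 i)).
Proof.
apply/funext => k; rewrite /fcons; case: (unliftP ord0 k) => [i ->|->] //.
Qed.

(** The form, for functions, of the condition that a partial derivative is nonzero. *)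
Definition depends_on n (i : 'I_n) (F : ('I_n -> C) -> C) :=
  exists u v : 'I_n -> C, (forall k, k != i -> u k = v k) /\ F u <> F v.

Lemma poly_roots_seq (P : {poly C}) : P != 0 ->
  exists rs : seq C, forall x, P.[x] = 0 -> x \in rs.
Proof.
move=> P0; have [rs Prs] := closed_field_poly_normal P; exists rs => x Px.
have : root P x by apply/rootP.
by rewrite Prs rootZ ?lead_coef_eq0// root_prod_XsubC.
Qed.

Lemma poly_fun_inj (P Q : {poly C}) : (forall x, P.[x] = Q.[x]) -> P = Q.
Proof.
move=> PQ; apply/eqP; rewrite -subr_eq0; apply/negPn/negP => D0.
pose rs : seq C := [seq k%:R | k <- iota 0 (size (P - Q))].
have := @max_poly_roots _ _ rs D0; rewrite size_map size_iota ltnn => H.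
have // : false; apply: H.
  by apply/allP => x _; apply/rootP; rewrite hornerD hornerN PQ subrr.
rewrite map_inj_uniq ?iota_uniq// => a b /eqP; rewrite eqr_nat => /eqP //.
Qed.

(** Put ['X] for the variable [i] and the values of [v] for the others: this turns [mderiv i] into
    the derivative of a univariate polynomial. Without dependence on [i] that polynomial is
    constant, so its derivative vanishes. *)
Lemma depends_on_mderiv n (p : mpoly n C) i v :
  meval v (mderiv i p) != 0 -> depends_on i (fun v => meval v p).
Proof.
move=> dp.
pose h k : {poly C} := if k == i then 'X else (v k)%:P.
pose u t k : C := if k == i then t else v k.
have hu t q : (mmap (@polyC C) h q).[t] = meval (u t) q.
  rewrite /meval /mmap horner_sum; apply: eq_bigr => m _.
  rewrite hornerM hornerC horner_prod; congr (_ * _); apply: eq_bigr => k _.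
  by rewrite horner_exp /h /u; case: ifP => _; rewrite ?hornerX ?hornerC.
have dh q : (mmap (@polyC C) h q)^`() = mmap (@polyC C) h (mderiv i q).
  elim/mpolyind: q => [|c m q _ _ IH]; first by rewrite mderiv0 !mmap0 deriv0.
  rewrite mderivD !mmapD derivD IH mderivZ mderivX !mmapZ !mmapX; congr (_ + _).
  rewrite derivM derivC mul0r add0r; congr (_ * _).
  rewrite /mmap1 (bigD1 i)//= [in RHS](bigD1 i)//= mnmBE mnm1E eqxx subn1.
  set A := \prod_(k < n | _) _; set B := \prod_(k < n | _) _.
  have AB : A = B.
    apply: eq_bigr => k ki; rewrite mnmBE mnm1E eq_sym.
    by rewrite (negbTE ki) subn0.
  rewrite derivM.
  have -> : A^`() = 0.
    rewrite /A [X in X^`()](_ : _ = (\prod_(k < n | k != i) v k ^+ m k)%:P) ?derivC//.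
    rewrite rmorph_prod; apply: eq_bigr => k ki.
    by rewrite /h (negbTE ki) rmorphXn.
  by rewrite AB /h eqxx derivXn mulr0 addr0 mulrA polyC_natr mulr_natl.
have [//|nd] := pselect (depends_on i (fun v => meval v p)).
have cst t : meval (u t) p = meval v p.
  apply: contrapT => ne; apply: nd; exists (u t), v; split=> // k ki.
  by rewrite /u (negbTE ki).
case/negP: dp; apply/eqP.
have -> : v = u (v i) by apply/funext => k; rewrite /u; case: eqP => [->|].
rewrite -hu -dh (_ : mmap _ _ p = (meval v p)%:P) ?derivC ?horner0//.
by apply: poly_fun_inj => x; rewrite hornerC hu.
Qed.

(** Induction on the degree of a monomial with nonzero coefficient. In degree 0 the value at the
    origin is that coefficient. Otherwise some derivative of [p] is nonzero at a point by induction,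
    so [p] takes two different values, one of which is nonzero. *)
Lemma mpoly_neq0_meval n (p : mpoly n C) : p != 0 -> exists v, meval v p != 0.
Proof.
move=> p0; have [m pm] : exists m, mcoeff m p != 0.
  apply: contrapT => nm; case/negP: p0; apply/eqP/mpolyP => m; rewrite mcoeff0.
  by apply/eqP/negPn/negP => pm; apply: nm; exists m.
have [d dm] : exists d, mdeg m = d by exists (mdeg m).
elim: d m dm p {p0} pm => [|d IH] m dm p pm.
  move/eqP: dm; rewrite mdeg_eq0 => /eqP m0; exists (fun=> 0).
  rewrite mevalE; move: pm; rewrite m0 => pm.
  rewrite (bigD1_seq (@mnm0 n)) ?mcoeff_msupp ?msupp_uniq//=.
  rewrite big1 ?mulr1 => [|k _]; last by rewrite mnm0E expr0.
  rewrite big1_seq ?addr0// => k /andP[k0 _].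
  have [i ki] : exists i, k i != 0%N.
    apply: contrapT => nk; case/eqP: k0; apply/mnmP => i; rewrite mnm0E.
    by apply/eqP/negPn/negP => ki; apply: nk; exists i.
  by rewrite (bigD1 i)//= expr0n (negbTE ki) mul0r mulr0.
have [i mi] : exists i, m i != 0%N.
  apply: contrapT => nm; suff : mdeg m = 0%N by rewrite dm.
  rewrite mdegE big1// => i _; apply/eqP/negPn/negP => mi; apply: nm; by exists i.
have [v Hv] : exists v, meval v (mderiv i p) != 0.
  apply: (IH (mnm_sub m (mnm1 i))).
    have := mdegD (mnm_sub m (mnm1 i)) (mnm1 i); rewrite submK ?lep1mP// mdeg1 dm addn1.
    by case.
  by rewrite mcoeff_mderiv submK ?lep1mP// mulrn_eq0.
have [u1 [u2 [_ ne]]] := depends_on_mderiv Hv.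
have [u10|u10] := eqVneq (meval u1 p) 0; last by exists u1.
by exists u2; apply/eqP => u20; apply: ne; rewrite u10 u20.
Qed.

End PolynomialFunctions.

(** * Zeros along the iterates of j *)

Section Iterates.
Variables (R : realType) (j : R[i] -> R[i]).
Hypothesis hj : is_modular_j j.
Local Notation C := R[i].

Lemma moebius_fraction (K : fieldType) (a b c d z : K) : a * d - b * c = 1 ->
  c != 0 -> c * z + d != 0 ->
  (a * z + b) / (c * z + d) = a / c - (c * (c * z + d))^-1.
Proof.
move=> abcd c0 den0; apply: (mulIf (mulf_neq0 c0 den0)).
rewrite mulrBl mulVf ?mulf_neq0//.
transitivity (a * (c * z + d) - (a * d - b * c)); last by rewrite abcd; field.
by field.
Qed.

(* The matrices [(AN + 1, -A^2; N^2, 1 - AN)] lie in [SL_2(Z)] and move the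
   upper half plane close to [A / N]. *)
Lemma SL2Z_approx (r e y : R) : 0 < e -> 0 < y -> exists a b c d : int,
  a * d - b * c = 1 /\ forall z : C, y <= Im z ->
    [/\ c%:~R * z + d%:~R != 0,
        0 < Im ((a%:~R * z + b%:~R) / (c%:~R * z + d%:~R)) &
        normc ((a%:~R * z + b%:~R) / (c%:~R * z + d%:~R) - r%:C) < e].
Proof.
(* The distance to [r] is at most [K / N]: [2 / N] comes from [A / N + 1 / N ^+ 2] against [r], and
   [y^-1 / N] from the term containing [z]. *)
move=> e0 y0; pose K := 2 + y^-1.
have K0 : 0 < K by rewrite addr_gt0// invr_gt0.
have [N N1 NK] : exists2 N : int, 1 <= N%:~R :> R & K / e < N%:~R.
  exists (Num.truncn (K / e)).+1%:Z; first by rewrite ler1z.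
  by rewrite -pmulrn; apply: truncnS_gt.
have N0 : 0 < N%:~R :> R by apply: lt_le_trans N1.
have [A A1 A2] : exists2 A : int, A%:~R <= r * N%:~R & r * N%:~R < A%:~R + 1.
  have := floor_itv (r * N%:~R); rewrite intrD => /andP[A1 A2].
  by exists (Num.floor (r * N%:~R)).
exists (A * N + 1), (- A ^+ 2), (N ^+ 2), (1 - A * N); split; first by ring.
move=> z yz; set a := (A * N + 1)%:~R; set b := (- A ^+ 2)%:~R.
set c := (N ^+ 2)%:~R; set d := (1 - A * N)%:~R.
pose n : R := N%:~R.
have cE : c = (n ^+ 2)%:C by rewrite /c /n !expr2 intrM rmorphM /= rmorph_int.
have z0 : 0 < Im z := lt_le_trans y0 yz.
have n2 : 0 < n ^+ 2 by rewrite exprn_gt0.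
have Iden : Im (c * z + d) = n ^+ 2 * Im z.
  by rewrite cImD Im_intr addr0 cE cImM /= mul0r addr0.
have I0 : 0 < Im (c * z + d) by rewrite Iden mulr_gt0.
have den0 : c * z + d != 0.
  by apply/eqP => E; move: I0; rewrite E ltxx.
have c0 : c != 0 by rewrite cE -normc_gt0 normc_real gtr0_norm.
have abcd : a * d - b * c = 1.
  by rewrite /a /b /c /d -!intrM -intrB (_ : _ - _ = 1)//; ring.
have E : (a * z + b) / (c * z + d) = a / c - (c * (c * z + d))^-1.
  exact: moebius_fraction.
have dn : n ^+ 2 * y <= normc (c * z + d).
  apply: (@le_trans _ _ (Im (c * z + d))).
    by rewrite Iden ler_pM2l.
  by apply: le_trans (Im_le_normc _); exact: ler_norm.
split=> //; rewrite E.
- have -> : a / c = ((A * N + 1)%:~R / n ^+ 2)%:C.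
    by rewrite cE /a -(rmorph_int (real_complex R)) -fmorphV -rmorphM.
  rewrite cImD /= add0r cImN Im_inv cE cImM /= mul0r addr0 mulNr opprK.
  rewrite -cE; apply: divr_gt0; first exact: mulr_gt0.
  by rewrite exprn_gt0// normc_gt0 mulf_neq0.
- have -> : a / c - (c * (c * z + d))^-1 - r%:C =
    ((A%:~R / n + n ^- 2) - r)%:C - (c * (c * z + d))^-1.
    have -> : a / c = (A%:~R / n + n ^- 2)%:C; last by rewrite rmorphB; ring.
    rewrite cE /a -(rmorph_int (real_complex R)) -fmorphV -rmorphM /=; congr (_%:C).
    by rewrite intrD intrM -/n; field; rewrite gt_eqF.
  apply: le_lt_trans (le_normcD _ _) _; rewrite normcN normc_real.
  have B1 : `|A%:~R / n + n ^- 2 - r| <= 2 / n.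
    have n0 : 0 < n by [].
    have -> : A%:~R / n + n ^- 2 - r = (A%:~R - r * n + n^-1) / n.
      by field; rewrite gt_eqF.
    rewrite normrM [`|n^-1|]gtr0_norm ?invr_gt0// ler_pM2r ?invr_gt0//.
    have m0 : 0 < n^-1 by rewrite invr_gt0.
    have m1 : n^-1 <= 1 by rewrite invf_le1.
    by move: A1 A2; rewrite -/n ler_norml => ? ?; lra.
  have B2 : normc (c * (c * z + d))^-1 <= y^-1 / n.
    rewrite normcV normcM cE normc_real gtr0_norm// -invfM lef_pV2; last 2 first.
    - by rewrite posrE mulr_gt0// -cE normc_gt0.
    - by rewrite posrE mulr_gt0.
    rewrite -cE; apply: (@le_trans _ _ (n ^+ 2 * (n ^+ 2 * y))); last first.
      by rewrite ler_pM2l.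
    rewrite mulrA mulrC ler_pM2r//.
    by rewrite -exprD -[leLHS]expr1 ler_weXn2l.
  apply: (@le_lt_trans _ _ (K / n)); first by rewrite /K mulrDl lerD.
  by rewrite ltr_pdivrMr// mulrC -ltr_pdivrMr.
Qed.

Lemma taylor_moebius (a b c d : int) (z : C) : c%:~R * z + d%:~R != 0 ->
  taylor (fun z => (a%:~R * z + b%:~R) / (c%:~R * z + d%:~R)) z.
Proof.
have lin (k l : int) : taylor (fun z : C => k%:~R * z + l%:~R) z.
  apply: taylorD; last exact: taylor_cst.
  by apply: taylorM; [exact: taylor_cst|exact: taylor_id].
by move=> den0; apply: taylorM; [exact: lin|apply: taylorV; [exact: lin|]].
Qed.

(** The definition peels off the last application of [j]; the induction on [n] needs the first
    one. *)
Lemma iter_domS n z : iter_dom j n.+1 z <-> 0 < Im z /\ iter_dom j n (j z).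
Proof.
elim: n => [|n IH]; first by split=> [[]|[]].
rewrite -[iter_dom j n.+2 z]/(iter_dom j n.+1 z /\ upper_half_plane (iter n.+1 j z)).
rewrite iterSr; split=> [[/IH[? ?] ?]|[? [? ?]]] //.
by split=> //; apply/IH.
Qed.

Lemma iter_dom_open n z : iter_dom j n z ->
  taylor (iter n j) z /\ near0 (fun w => iter_dom j n (z + w)).
Proof.
elim: n => [|n IH] /=; first by move=> _; split; [exact: taylor_id|exact: near0T].
move=> [/IH[tn nn] zn]; split.
  by apply: (@taylor_comp _ j (iter n j)) => //; exact: taylor_j.
apply: near0W (near0I nn (taylor_continuous tn zn)) => w [dw Hw]; split=> //.
rewrite /upper_half_plane /=; have := le_lt_trans (Im_le_normc _) Hw.
by rewrite cImD cImN ltr_norml => /andP[? _]; lra.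
Qed.

Lemma iter_pointS n z : iter_point j n.+1 z = fcons z (iter_point j n (j z)).
Proof.
apply/funext => k; rewrite /iter_point /fcons; case: unliftP => [i ->|->] //.
by rewrite lift0 iterSr.
Qed.

Lemma iter_dom_le n k z : (k <= n)%N -> iter_dom j n z -> iter_dom j k z.
Proof.
elim: n => [|n IH]; first by rewrite leqn0 => /eqP ->.
by rewrite leq_eqVlt => /predU1P[-> //|kn] [/(IH kn)].
Qed.

(** In a finite set the positive imaginary parts have a positive lower bound. *)
Lemma infinite_small_Im (A : set C) :
  (forall e, 0 < e -> exists2 z, A z & 0 < Im z < e) -> infinite_set A.
Proof.
move=> H /finite_seqP[s As].
have [e e0 He] : exists2 e, 0 < e & forall z, z \in s -> 0 < Im z -> e <= Im z.
  elim: s {As} => [|x s [e e0 He]]; first by exists 1.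
  have [x0|x0] := ltP 0 (Im x).
    exists (Num.min e (Im x)); first by rewrite lt_min e0.
    move=> z; rewrite inE => /predU1P[->|/He zs] z0; rewrite ge_min ?lexx ?orbT//.
    by rewrite zs.
  exists e => // z; rewrite inE => /predU1P[->|/He//].
  by rewrite ltNge x0.
have [z Az /andP[z0 ze]] := H _ e0.
rewrite As /= in Az; have := He z Az z0; lra.
Qed.

Lemma rational_point (z : C) (d : R) : 0 < d -> exists s t : rat,
  normc ((ratr s +i* ratr t) - z) < d.
Proof.
move=> d0; have rat_near (x : R) : exists s : rat, `|ratr s - x| < d / 2.
  have : x - d / 2 < x + d / 2 by lra.
  move=> /rat_in_itvoo[s]; rewrite in_itv /= => /andP[? ?]; exists s.
  by rewrite ltr_norml; lra.
have [s Hs] := rat_near (Re z); have [t Ht] := rat_near (Im z); exists s, t.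
apply: le_lt_trans (normc_le_ReIm _) _; rewrite cReD cImD cReN cImN /=; lra.
Qed.

(** A countable set has Lebesgue measure 0, while the unit interval has measure 1. *)
Lemma uncountable_real : ~ countable [set: R].
Proof.
move=> H; have c01 : countable (`[0, 1]%classic : set R).
  by apply: sub_countable H; exact: subset_card_le.
have := countable_lebesgue_measure0 c01.
by rewrite lebesgue_measure_itv /= lte_fin ltr01 oppr0 adde0 => -[] /eqP; rewrite oner_eq0.
Qed.

(** * The induction step: infinitely many solutions at level [n.+1] *)

Section Step.
Variables (n : nat) (F : ('I_n.+2 -> C) -> C).
Hypothesis pF : polyfun F.
(** The first coordinate is decoupled from the others: by the invariance of [j], moving [z] by a
    matrix of SL_2(Z) affects this coordinate only. *)
Let G x z := F (fcons x (iter_point j n (j z))).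
Let solutions := [set z | iter_dom j n.+1 z /\ F (iter_point j n.+1 z) = 0].

Lemma solution_moebius (a b c d : int) z (g := (a%:~R * z + b%:~R) / (c%:~R * z + d%:~R)) :
  a * d - b * c = 1 -> iter_dom j n.+1 z -> 0 < Im g -> G g z = 0 -> solutions g.
Proof.
move=> abcd /iter_domS[z0 jz] g0 Gg.
have jg : j g = j z by exact: j_SL2Z.
by split; [apply/iter_domS; rewrite jg|rewrite iter_pointS jg].
Qed.

(** All images of [z] under SL_2(Z) are solutions, and matrices moving [z] close to the real point 0
    make their imaginary parts arbitrarily small. *)
Lemma infinite_solutions_fiber z :
  iter_dom j n.+1 z -> (forall x, G x z = 0) -> infinite_set solutions.
Proof.
move=> dz Gz; have [z0 _] := (iter_domS n z).1 dz.
apply: infinite_small_Im => e e0.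
have [a [b [c [d [abcd H]]]]] := SL2Z_approx 0 e0 z0.
have [_ g0 ge] := H z (lexx _).
exists ((a%:~R * z + b%:~R) / (c%:~R * z + d%:~R)).
  exact: solution_moebius.
rewrite g0 /=; apply: le_lt_trans ge; rewrite subr0.
by apply: le_trans (Im_le_normc _); exact: ler_norm.
Qed.

(** Hurwitz's theorem is applied to the perturbation [G (g z) z] of [G r z], where [g] in SL_2(Z)
    maps a disc around [z0] close to [r]. A zero [z] yields the solution [g z], of small imaginary
    part. *)
Lemma infinite_solutions_isolated (r : R) z0 : iter_dom j n.+1 z0 ->
  G r%:C z0 = 0 -> ~ near0 (fun w => G r%:C (z0 + w) = 0) ->
  infinite_set solutions.
Proof.
move=> dz0 Gz0 nz.
have [_ [d d0 dH]] := iter_dom_open dz0.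
have [i0 _] := (iter_domS n z0).1 dz0.
(* The closed disc of radius [t] stays in the domain and at height at least [Im z0 / 2], the height
   then given to [SL2Z_approx]. *)
pose t := Num.min (d / 2) (Im z0 / 2).
have t0 : 0 < t by rewrite lt_min !divr_gt0.
have disc z : normc (z - z0) <= t -> iter_dom j n.+1 z /\ Im z0 / 2 <= Im z.
  move=> zt; split.
    have := dH (z - z0); rewrite [z0 + _]addrC subrK; apply; apply: le_lt_trans zt _.
    by apply: (@le_lt_trans _ _ (d / 2)); [rewrite ge_min lexx|lra].
  have := le_trans (Im_le_normc _) zt; rewrite le_min cImD cImN !ler_norml.
  by move=> /andP[_ /andP[? _]]; lra.
have tpt k z : normc (z - z0) <= t -> taylor (fun z => iter_point j n (j z) k) z.
  move=> /disc[dz _].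
  have [] // := @iter_dom_open k.+1 z; first by apply: iter_dom_le dz; rewrite ltnS -ltnS.
  by move=> tk _; apply: taylor_near tk; apply: near0T => w; rewrite iterSr.
have tG x z : taylor x z -> normc (z - z0) <= t -> taylor (fun z => G (x z) z) z.
  move=> tx zt; apply: (taylor_polyfun (v := fun z => fcons (x z) (iter_point j n (j z)))) => // k.
  rewrite /fcons; case: (unlift ord0 k) => [i|//]; exact: tpt.
have [B B1 HB] : exists2 B, `|r| + 1 <= B & forall z k, normc (z - z0) <= t ->
    normc (iter_point j n (j z) k) <= B.
  have /fin_all_exists[M HM] : forall k, exists M, forall z, normc (z - z0) <= t ->
      normc (iter_point j n (j z) k) <= M.
    move=> k; have [z1 _ zM] := disc_normc_max (ltW t0) (tpt k).
    by exists (normc (iter_point j n (j z1) k)).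
  have S0 (P : pred 'I_n.+1) : 0 <= \sum_(k | P k) `|M k| by apply: sumr_ge0.
  exists (`|r| + 1 + \sum_k `|M k|); first by rewrite lerDl S0.
  move=> z k zt; apply: le_trans (HM k z zt) _; rewrite (bigD1 k)//=.
  by have := S0 (fun i => i != k); have := ler_norm (M k); have := normr_ge0 r; lra.
have [L L0 HL] := polyfun_lipschitz B pF.
have [s [e [s0 st _ e0 hur]]] :=
  hurwitz t0 t0 (fun z => tG _ _ (taylor_cst r%:C z)) Gz0 nz.
apply: infinite_small_Im => eta eta0.
(* The bound 1 keeps [g z] within [B], the bound [eta] controls the imaginary part, and the last one
   gives [L * del < e], the tolerance in Hurwitz's theorem. *)
pose del := Num.min (Num.min 1 eta) (e / (2 * (L + 1))).
have L1 : 0 < 2 * (L + 1) by lra.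
have del0 : 0 < del by rewrite !lt_min ltr01 eta0 divr_gt0.
have hi0 : 0 < Im z0 / 2 by lra.
have [a [b [c [d' [abcd H]]]]] := SL2Z_approx r del0 hi0.
pose g z : C := (a%:~R * z + b%:~R) / (c%:~R * z + d'%:~R).
have gH z : normc (z - z0) <= s -> [/\ c%:~R * z + d'%:~R != 0, 0 < Im (g z)
    & normc (g z - r%:C) < del].
  by move=> zs; apply: H; have [] := disc _ (le_trans zs st).
have [||z zs Gz] := hur (fun z => G (g z) z).
- move=> z zs; apply: tG; last exact: le_trans st.
  by apply: taylor_moebius; have [] := gH _ zs.
- move=> z zs; have [_ _ gdel] := gH _ zs.
  have rB : normc r%:C <= B by rewrite normc_real; lra.
  have gB : normc (g z) <= B.
    have : del <= 1 by rewrite !ge_min lexx.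
    have := normcD_ge (g z) (- r%:C); rewrite normcN normc_real; lra.
  have bnd x : normc x <= B -> forall k, normc (fcons x (iter_point j n (j z)) k) <= B.
    move=> xB k; rewrite /fcons; case: (unlift ord0 k) => [i|//].
    by apply: HB; exact: le_trans st.
  have [|_] := HL _ _ _ (ltW del0) (bnd _ gB) (bnd _ rB).
    move=> k; rewrite /fcons; case: (unlift ord0 k) => [i|]; last exact: ltW.
    by rewrite subrr normc0 ltW.
  move=> /le_lt_trans; apply.
  have : del * (2 * (L + 1)) <= e.
    by rewrite -ler_pdivlMr// ge_min lexx orbT.
  by nra.
- have [_ g0 gdel] := gH _ zs.
  exists (g z).
    by apply: solution_moebius => //; have [] := disc _ (le_trans zs st).
  rewrite g0 /=; apply: (@lt_le_trans _ _ del); last first.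
    by rewrite !ge_min lexx orbT.
  apply: le_lt_trans gdel; apply: le_trans (Im_le_normc _).
  by rewrite cImD cImN subr0; exact: ler_norm.
Qed.

(* If [G r] vanishes near some point for all but finitely many real [r], then,
   [R] being uncountable, [G r z = 0] for infinitely many [r] at one and the same
   Gaussian rational [z], so that the polynomial [G ^~ z] is zero. *)
Lemma common_fiber (bad : seq C) :
  (forall r : R, r%:C \notin bad -> exists2 z0, iter_dom j n.+1 z0 &
     near0 (fun w => G r%:C (z0 + w) = 0)) ->
  exists2 z, iter_dom j n.+1 z & forall x, G x z = 0.
Proof.
move=> Hr; apply: contrapT => nfib.
pose q (st : rat * rat) : C := ratr st.1 +i* ratr st.2.
pose S st := [set r : R | iter_dom j n.+1 (q st) /\ G r%:C (q st) = 0].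
have cfin (s : seq C) : countable [set r : R | r%:C \in s].
  apply: finite_set_countable; apply: sub_finite_set (finite_image Re (finite_seq s)).
  by move=> r rs; exists r%:C.
have cS st : countable (S st).
  have [dq|ndq] := pselect (iter_dom j n.+1 (q st)); last first.
    suff -> : S st = set0 by exact: countable0.
    by apply/seteqP; split => // r [].
  have [P HP] := polyfun_fcons_poly (iter_point j n (j (q st))) pF.
  have P0 : P != 0.
    apply/eqP => P0; apply: nfib; exists (q st) => // x.
    by rewrite /G HP P0 horner0.
  have [rs Hrs] := poly_roots_seq P0.
  apply: sub_countable (cfin rs); apply: subset_card_le => r [_].
  by rewrite /G HP => /Hrs.
apply: uncountable_real.
(* Without a common fiber each [S st] lies in the root set of a nonzero polynomial; with the
   exceptional reals, indexed by [None], these countable sets would cover the real line. *)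
pose T o := if o is Some st then S st else [set r : R | r%:C \in bad].
have cT : countable (\bigcup_(o in [set: option (rat * rat)]) T o).
  apply: bigcup_countable => [|[st|] _]; [exact: countableP|exact: cS|exact: cfin].
apply: sub_countable cT; apply: subset_card_le => r _.
have [rb|rb] := boolP (r%:C \in bad); first by exists None.
have [z0 dz0 [d d0 Hd]] := Hr r rb.
have [_ [d' d'0 Hd']] := iter_dom_open dz0.
have m0 : 0 < Num.min d d' by rewrite lt_min d0.
have [s [t]] := rational_point z0 m0.
rewrite lt_min => /andP[/Hd H1 /Hd' H2]; exists (Some (s, t)) => //.
by split; [move: H2|move: H1]; rewrite /q /= addrC subrK.
Qed.

Lemma infinite_solutions :
  (forall q : ('I_n.+1 -> C) -> C, polyfun q -> depends_on ord_max q ->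
     exists2 w, iter_dom j n w & q (iter_point j n w) = 0) ->
  depends_on ord_max F -> infinite_set solutions.
Proof.
move=> IH [v [v' [vv' Fvv']]].
pose tl (u : 'I_n.+2 -> C) (i : 'I_n.+1) := u (lift ord0 i).
have [P HP] := polyfun_fcons_poly (tl v) pF.
have [P' HP'] := polyfun_fcons_poly (tl v') pF.
(* [v] and [v'] agree at [ord0], so [P = P'] would force [F v = F v']. *)
have PP' : P - P' != 0.
  rewrite subr_eq0; apply/eqP => E; apply: Fvv'.
  by rewrite (fcons_eta v) (fcons_eta v') HP HP' E vv'.
have [bad Hbad] := poly_roots_seq PP'.
(* Outside the roots of [P - P'], fixing the first variable at [r] leaves a function that depends on
   the last one; the induction hypothesis provides [w], and surjectivity of [j] a preimage of it. *)
have zero (r : R) : r%:C \notin bad ->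
    exists2 z0, iter_dom j n.+1 z0 & G r%:C z0 = 0.
  move=> rb; have [||w dw qw] := IH (fun y => F (fcons r%:C y)).
  - exact: polyfun_fcons.
  - exists (tl v), (tl v'); split.
      move=> k kn; apply: vv'; apply: contra kn => /eqP kn.
      by apply/eqP/val_inj; have := congr1 (@nat_of_ord _) kn; rewrite lift0 => -[].
    rewrite HP HP' => E; case/negP: rb; apply: Hbad.
    by rewrite hornerD hornerN E subrr.
  have [z0 z00 jz0] := j_surj hj w; exists z0; last by rewrite /G jz0.
  by apply/iter_domS; rewrite jz0.
have [[r [z0 [dz0 Gz0 nz]]]|niso] := pselect (exists (r : R) z0,
    [/\ iter_dom j n.+1 z0, G r%:C z0 = 0 & ~ near0 (fun w => G r%:C (z0 + w) = 0)]).
  exact: infinite_solutions_isolated Gz0 nz.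
have [r rb|z dz Gz] := @common_fiber bad; last exact: infinite_solutions_fiber Gz.
have [z0 dz0 Gz0] := zero r rb; exists z0 => //.
by apply: contrapT => nz; apply: niso; exists r, z0.
Qed.

End Step.

(** The induction carries the existence of one zero only: for [n = 0] this is the fundamental
    theorem of algebra, where the zeros are finite in number. Each further level gives infinitely
    many, of which one is kept. *)
Lemma polyfun_zero n (F : ('I_n.+1 -> C) -> C) : polyfun F ->
  depends_on ord_max F -> exists2 z, iter_dom j n z & F (iter_point j n z) = 0.
Proof.
elim: n F => [|n IH] F pF dF.
  have [P HP] := polyfun_poly (fun=> 'X) pF.
  have FE v : F v = P.[v ord0].
    by rewrite -HP; congr F; apply/funext => k; rewrite hornerX ord1.
  have [|z Pz] := closed_rootP P _.
    apply/negP => /size_poly1P[c _ Pc]; case: dF => v [v' [_]].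
    by rewrite !FE Pc !hornerC.
  by exists z => //; rewrite FE; apply/rootP.
by have /infinite_setN0[z [dz Fz]] := infinite_solutions pF IH dF; exists z.
Qed.

End Iterates.

(* The variable of index 0 is X and the variable of index k >= 1 is Y_k; in
   particular Y_n has index [ord_max]. *)
Theorem theorem1p3 (R : realType) (j : R[i] -> R[i]) (hj : is_modular_j j)
    (n : nat) (hn : (1 <= n)%N) (p : mpoly n.+1 R[i])
    (hp : irreducible_mpoly p) (hY : mderiv ord_max p != 0) :
  infinite_set [set z | iter_dom j n z /\ zero_locus p (iter_point j n z)].
Proof.
(* A point where the derivative in [Y_n] is nonzero shows that the values of [p] depend on the last
   variable. *)
have [v dv] := mpoly_neq0_meval hY.
case: n hn p hp hY v dv => // n _ p _ _ v dv.
have pF := polyfun_meval p.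
apply: (infinite_solutions hj pF); last exact: depends_on_mderiv dv.
by move=> q; exact: polyfun_zero.
Qed.
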